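(* Let $K\ge3$ and consider the $K$-receiver DM BC with message index set $\mathsf{E}=\{\overline{\{K\}},\overline{\{K-1\}}\}$, $S_p=[1:K-2]$. Suppose the channel belongs to one of the classes (A) $Y_j$ is more capable than $Y_{K-1}$ for all $j\in S_p$, and $Y_{K-1}$ is more capable than $Y_K$; (B) $Y_i$ is less noisy than $Y_K$ for all $i\in S_p\cup\{K-1\}$. Then the capacity region is the set of rate pairs $(R_{\overline{K}},R_{\overline{K-1}})$ such that for some pmf $p(u,x)$ (with $U$ finite and $U\to X\to(Y_1,\dots,Y_K)$ a Markov chain) $R_{\overline{K-1}}\le I(U;Y_K)$, $R_{\overline{K-1}}+R_{\overline{K}}\le I(X;Y_j|U)+I(U;Y_K)$ for all $j\in S_p\cup\{K-1\}$, $R_{\overline{K-1}}+R_{\overline{K}}\le I(X;Y_{K-1})$.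
   Context: DM BC with finite alphabets and transition pmf $W(y_1,\dots,y_K|x)$ used memorylessly without feedback; message $M_S$ required by all receivers in $S$; achievability and capacity region in the usual sense (error probability: some receiver mis-decodes a required message). $M_{\overline{K}}$ is the message required by receivers $1,\dots,K-1$ and $M_{\overline{K-1}}$ the message required by receivers in $[1:K]\setminus\{K-1\}$. Receiver $Y_s$ is less noisy than $Y_c$ if $I(U;Y_s)\ge I(U;Y_c)$ for all $p(u,x)$ with $U\to X\to(Y_s,Y_c)$. Receiver $Y_s$ is more capable than $Y_c$ if $I(X;Y_s)\ge I(X;Y_c)$ for all $p(x)$. *)

(* Defs.v *)
From Stdlib Require Import Reals.
From mathcomp Require Import all_boot.

Set Implicit Arguments.
Unset Strict Implicit.
Unset Printing Implicit Defensive.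

Local Open Scope R_scope.

Definition rsum (T : finType) (f : T -> R) : R := \big[Rplus/0]_(t : T) f t.
Definition rprod (T : finType) (f : T -> R) : R := \big[Rmult/1]_(t : T) f t.

Definition log2 (x : R) : R := ln x / ln 2.

Definition plogq (p q : R) : R :=
  if Req_EM_T p 0 then 0 else p * log2 (p / q).

Definition is_pmf (A : finType) (p : A -> R) : Prop :=
  (forall a, 0 <= p a) /\ rsum p = 1.
Definition is_pmf2 (A B : finType) (p : A -> B -> R) : Prop :=
  (forall a b, 0 <= p a b) /\ rsum (fun a => rsum (fun b => p a b)) = 1.

Definition mutinf (A B : finType) (p : A -> B -> R) : R :=
  rsum (fun a => rsum (fun b =>
    plogq (p a b) (rsum (fun b' => p a b') * rsum (fun a' => p a' b)))).

Definition cmutinf (C A B : finType) (p : C -> A -> B -> R) : R :=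
  rsum (fun c => rsum (fun a => rsum (fun b =>
    let pc  := rsum (fun a' => rsum (fun b' => p c a' b')) in
    let pca := rsum (fun b' => p c a b') in
    let pcb := rsum (fun a' => p c a' b) in
    plogq (p c a b) (pca * pcb / pc)))).

(* Receivers are numbered 1..K; receiver r is the ordinal r-1 : 'I_K. *)
Definition rcv (K : nat) (i : 'I_K) : nat := (nat_of_ord i).+1.

Definition outT (K : nat) (Y : 'I_K -> finType) : finType :=
  {dffun forall i : 'I_K, Y i}.

Definition is_channel (K : nat) (X : finType) (Y : 'I_K -> finType)
  (W : X -> outT Y -> R) : Prop :=
  forall x, is_pmf (W x).

Definition marg (K : nat) (X : finType) (Y : 'I_K -> finType)
  (W : X -> outT Y -> R) (j : 'I_K) (x : X) (y : Y j) : R :=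
  rsum (fun ya : outT Y => if ya j == y then W x ya else 0).
Arguments marg {K X Y} W j x y.

Definition I_UY (K : nat) (X : finType) (Y : 'I_K -> finType)
  (W : X -> outT Y -> R) (U : finType) (p : U -> X -> R) (j : 'I_K) : R :=
  mutinf (fun (u : U) (y : Y j) => rsum (fun x => p u x * marg W j x y)).
Definition I_XY_given_U (K : nat) (X : finType) (Y : 'I_K -> finType)
  (W : X -> outT Y -> R) (U : finType) (p : U -> X -> R) (j : 'I_K) : R :=
  cmutinf (fun (u : U) (x : X) (y : Y j) => p u x * marg W j x y).
Definition I_XY (K : nat) (X : finType) (Y : 'I_K -> finType)
  (W : X -> outT Y -> R) (px : X -> R) (j : 'I_K) : R :=
  mutinf (fun (x : X) (y : Y j) => px x * marg W j x y).

Definition less_noisy (K : nat) (X : finType) (Y : 'I_K -> finType)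
  (W : X -> outT Y -> R) (s c : 'I_K) : Prop :=
  forall (U : finType) (p : U -> X -> R), is_pmf2 p ->
    I_UY W p c <= I_UY W p s.

Definition more_capable (K : nat) (X : finType) (Y : 'I_K -> finType)
  (W : X -> outT Y -> R) (s c : 'I_K) : Prop :=
  forall px : X -> R, is_pmf px -> I_XY W px c <= I_XY W px s.

(* Two messages: M1 = M_{bar K} (required by receivers 1..K-1) with N1
   values, M2 = M_{bar (K-1)} (required by receivers in [1:K] \ {K-1})
   with N2 values. Each decoder outputs a pair of estimates; only the
   components of the messages the receiver requires are checked. *)
Record code (K : nat) (X : finType) (Y : 'I_K -> finType) (n N1 N2 : nat) :=
  Code {
    enc : 'I_N1 -> 'I_N2 -> 'I_n -> X;
    dec : forall i : 'I_K, ('I_n -> Y i) -> 'I_N1 * 'I_N2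
  }.
Arguments enc {K X Y n N1 N2} c m1 m2 t.
Arguments dec {K X Y n N1 N2} c i yi.

Definition req1 (K : nat) (i : 'I_K) : bool := rcv i != K.
Definition req2 (K : nat) (i : 'I_K) : bool := rcv i != K.-1.

Definition err_event (K : nat) (X : finType) (Y : 'I_K -> finType)
  (n N1 N2 : nat) (c : code X Y n N1 N2) (m1 : 'I_N1) (m2 : 'I_N2)
  (yn : {ffun 'I_n -> outT Y}) : bool :=
  [exists i : 'I_K,
     (req1 i && ((dec c i (fun t => yn t i)).1 != m1))
  || (req2 i && ((dec c i (fun t => yn t i)).2 != m2))].

Definition Pe (K : nat) (X : finType) (Y : 'I_K -> finType)
  (W : X -> outT Y -> R) (n N1 N2 : nat) (c : code X Y n N1 N2) : R :=
  rsum (fun m1 : 'I_N1 => rsum (fun m2 : 'I_N2 =>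
    rsum (fun yn : {ffun 'I_n -> outT Y} =>
      rprod (fun t : 'I_n => W (enc c m1 m2 t) (yn t)) *
      (if err_event c m1 m2 yn then 1 else 0))))
  / (INR N1 * INR N2).

(* (R1,R2) = (R_{bar K}, R_{bar (K-1)}) achievable: a sequence of
   (2^{nR1}, 2^{nR2}, n) codes with error probability -> 0 *)
Definition achievable (K : nat) (X : finType) (Y : 'I_K -> finType)
  (W : X -> outT Y -> R) (R1 R2 : R) : Prop :=
  0 <= R1 /\ 0 <= R2 /\
  exists (N1 N2 : nat -> nat) (c : forall n, code X Y n (N1 n) (N2 n)),
    (forall n, Rpower 2 (INR n * R1) <= INR (N1 n)) /\
    (forall n, Rpower 2 (INR n * R2) <= INR (N2 n)) /\
    Un_cv (fun n => Pe W (c n)) 0.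

Definition capacity_region (K : nat) (X : finType) (Y : 'I_K -> finType)
  (W : X -> outT Y -> R) (R1 R2 : R) : Prop :=
  forall eps, 0 < eps ->
    exists a b, achievable W a b /\ Rabs (a - R1) < eps /\ Rabs (b - R2) < eps.

Definition classA (K : nat) (X : finType) (Y : 'I_K -> finType)
  (W : X -> outT Y -> R) : Prop :=
  (forall j jK1 : 'I_K, (rcv j <= K - 2)%N -> rcv jK1 = K.-1 ->
     more_capable W j jK1) /\
  (forall jK1 jK : 'I_K, rcv jK1 = K.-1 -> rcv jK = K ->
     more_capable W jK1 jK).

Definition classB (K : nat) (X : finType) (Y : 'I_K -> finType)
  (W : X -> outT Y -> R) : Prop :=
  forall i jK : 'I_K, (rcv i <= K.-1)%N -> rcv jK = K -> less_noisy W i jK.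

Definition region (K : nat) (X : finType) (Y : 'I_K -> finType)
  (W : X -> outT Y -> R) (R1 R2 : R) : Prop :=
  0 <= R1 /\ 0 <= R2 /\
  exists (U : finType) (p : U -> X -> R), is_pmf2 p /\
    (forall jK : 'I_K, rcv jK = K -> R2 <= I_UY W p jK) /\
    (forall j jK : 'I_K, (rcv j <= K.-1)%N -> rcv jK = K ->
       R2 + R1 <= I_XY_given_U W p j + I_UY W p jK) /\
    (forall jK1 : 'I_K, rcv jK1 = K.-1 ->
       R2 + R1 <= I_XY W (fun x => rsum (fun u => p u x)) jK1).

(* Main.v *)
Require Import Defs.
From Stdlib Require Import Reals Lra.
From mathcomp Require Import all_boot all_algebra.
From mathcomp Require Import boolp Rstruct.

Set Implicit Arguments.
Unset Strict Implicit.
Unset Printing Implicit Defensive.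

Local Open Scope R_scope.

(** Achievability: superposition coding with rate splitting. The cloud centre carries the
message of rate [R2] together with a part of the message of rate [R1], receiver [K] decodes the
cloud only, and all other receivers decode both layers; either class of channels makes
[R1 + R2 <= I(X;Y_j)] hold for each of them. A one-shot random coding bound with threshold
tests on information densities is combined with Chebyshev's inequality.

Converse: for class A take [U_i = (M2, Y_K^{i-1}, Y_{K-1,i+1}^n)]; exchanging the outputs of
receiver [K-1] for those of receiver [K] one at a time telescopes (Csiszár's sum identity). For
class B take [U_i = (M2, Y_K^{i-1})]; the same exchange shows that the less noisy past of [Y_j]
is more informative than that of [Y_K]. The single-letter region is closed because
Carathéodory's theorem bounds the alphabet of [U]. *)

Local Notation "\sum_ ( i | P ) F" := (\big[Rplus/0]_(i | P%B) F) : R_scope.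
Local Notation "\sum_ ( i : t ) F" := (\big[Rplus/0]_(i : t) F) : R_scope.
Local Notation "\sum_ ( i <- s ) F" := (\big[Rplus/0]_(i <- s) F) : R_scope.
Local Notation "\sum_ ( i < n ) F" := (\big[Rplus/0]_(i < n) F) : R_scope.
Local Notation "\sum_ i F" := (\big[Rplus/0]_i F) : R_scope.
Local Notation "\prod_ i F" := (\big[Rmult/1]_i F) : R_scope.

Section FiniteSums.
Variables (I J : finType).
Implicit Types (P : pred I) (F G : I -> R).

Lemma sumR_ge0 P F : (forall i, P i -> 0 <= F i) -> 0 <= \sum_(i | P i) F i.
Proof. by move=> F0; apply: big_ind => // [|x y]; lra. Qed.

Lemma leR_sum P F G : (forall i, P i -> F i <= G i) ->
  \sum_(i | P i) F i <= \sum_(i | P i) G i.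
Proof. by move=> FG; apply: big_ind2 => // [|x1 x2 y1 y2]; lra. Qed.

Lemma sumRN P F : \sum_(i | P i) - F i = - \sum_(i | P i) F i.
Proof. exact: GRing.sumrN. Qed.

Lemma sumRB P F G :
  \sum_(i | P i) (F i - G i) = \sum_(i | P i) F i - \sum_(i | P i) G i.
Proof. exact: GRing.sumrB. Qed.

Lemma sumR_mull P x F : \sum_(i | P i) x * F i = x * \sum_(i | P i) F i.
Proof. by rewrite big_distrr. Qed.

Lemma sumR_mulr P x F : \sum_(i | P i) F i * x = (\sum_(i | P i) F i) * x.
Proof. by rewrite big_distrl. Qed.

Lemma sumR_const x : \sum_(i : I) x = INR #|I| * x.
Proof. by rewrite big_const; elim: #|I| => [|n IH]; rewrite ?iterS ?S_INR /= ?IH; lra. Qed.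

Lemma sumR_const_neq (i : I) x : \sum_(j | j != i) x = INR #|I|.-1 * x.
Proof.
rewrite -(cardC1 i) (eq_bigl (mem (predC1 i))) // big_const.
by elim: #|_| => [|n IH]; rewrite ?iterS ?S_INR /= ?IH; lra.
Qed.

Lemma leR_sum_term_cond P F i : P i -> (forall j, P j -> 0 <= F j) ->
  F i <= \sum_(j | P j) F j.
Proof.
move=> Pi F0; rewrite (bigD1 i) //= -{1}(Rplus_0_r (F i)).
by apply: Rplus_le_compat_l; apply: sumR_ge0 => j /andP[Pj _]; apply: F0.
Qed.

Lemma leR_sum_term F i : (forall j, 0 <= F j) -> F i <= \sum_j F j.
Proof. by move=> F0; apply: leR_sum_term_cond. Qed.

Lemma sumR_eq0 F : (forall i, 0 <= F i) -> \sum_i F i = 0 -> forall i, F i = 0.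
Proof. by move=> F0 S0 i; have := leR_sum_term i F0; have := F0 i; lra. Qed.

Lemma sumR_fiber (f : I -> J) F : \sum_i F i = \sum_j \sum_(i | f i == j) F i.
Proof. exact: partition_big. Qed.

Lemma prodR_ge0 F : (forall i, 0 <= F i) -> 0 <= \prod_i F i.
Proof. by move=> F0; apply: big_ind => [|x y|i _]; [lra | apply: Rmult_le_pos | apply: F0]. Qed.

Lemma prodR_gt0 F : (forall i, 0 < F i) -> 0 < \prod_i F i.
Proof.
by move=> F0; apply: big_ind => [|x y|i _]; [lra | apply: Rmult_lt_0_compat | apply: F0].
Qed.

Lemma prodR_eq0 F i : F i = 0 -> \prod_j F j = 0.
Proof. by move=> Fi; rewrite (bigD1 i) //= Fi Rmult_0_l. Qed.

Lemma sumR_pair (F : I * J -> R) : \sum_w F w = \sum_i \sum_j F (i, j).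
Proof. by rewrite pair_bigA; apply: eq_bigr => -[]. Qed.

Lemma sumR_pair_neq (F : I * J -> R) m : \sum_(m' | m' != m) F m' =
  \sum_(j | j != m.2) F (m.1, j) + \sum_(i | i != m.1) \sum_j F (i, j).
Proof.
have -> : \sum_(m' | m' != m) F m' = \sum_i \sum_(j | (i, j) != m) F (i, j).
  by rewrite pair_big_dep /=; apply: eq_big => -[].
rewrite (bigD1 m.1) //=; congr (_ + _); last apply: eq_bigr => i im.
  by apply: eq_bigl => j; case: m => a b; rewrite xpair_eqE eqxx.
by apply: eq_bigl => j; case: m im => a b /= /negbTE ia; rewrite xpair_eqE ia.
Qed.

End FiniteSums.

Lemma telescope_sumR_ord (u : nat -> R) m : \sum_(i < m) (u i.+1 - u i) = u m - u 0%N.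
Proof.
rewrite -(big_mkord xpredT (fun i => u i.+1 - u i)).
exact: (GRing.telescope_sumr u (leq0n m)).
Qed.

Definition ltRb (x y : R) : bool := Rlt_dec x y.

Lemma ltRbP x y : reflect (x < y) (ltRb x y).
Proof. exact: sumboolP. Qed.

Lemma INR_gt0 n : (0 < n)%N -> 0 < INR n.
Proof. by move=> n0; apply: lt_0_INR; apply/ltP. Qed.

(** * Laws, kernels and expectations on finite types *)

Definition expect (A : finType) (P f : A -> R) : R := \sum_a P a * f a.
Definition indic (b : bool) : R := if b then 1 else 0.

Local Notation "\E_ ( a <- P ) F" := (expect P (fun a => F))
  (at level 41, F at level 41, a binder, format "\E_ ( a  <-  P )  F") : R_scope.
Local Notation "\Pr_ ( a <- P ) E" := (expect P (fun a => indic E))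
  (at level 41, E at level 41, a binder, format "\Pr_ ( a  <-  P )  E") : R_scope.

Lemma indic_ge0 b : 0 <= indic b.
Proof. by case: b; rewrite /indic; lra. Qed.

Lemma indic_le1 b : indic b <= 1.
Proof. by case: b; rewrite /indic; lra. Qed.

Lemma pmf_ge0 (A : finType) (P : A -> R) : is_pmf P -> forall a, 0 <= P a.
Proof. by case. Qed.

Lemma pmf_sum1 (A : finType) (P : A -> R) : is_pmf P -> \sum_a P a = 1.
Proof. by case. Qed.

Section Expectation.
Variables (A B : finType).
Implicit Types (P : A -> R) (f g : A -> R).

Lemma eq_expect P f g : (forall a, f a = g a) -> \E_(a <- P) f a = \E_(a <- P) g a.
Proof. by move=> fg; apply: eq_bigr => a _; rewrite fg. Qed.

Lemma eq_expect_pos P f g : (forall a, 0 <= P a) -> (forall a, 0 < P a -> f a = g a) ->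
  \E_(a <- P) f a = \E_(a <- P) g a.
Proof.
by move=> P0 fg; apply: eq_bigr => a _; case: (P0 a) => [/fg ->|<-]; rewrite ?Rmult_0_l.
Qed.

Lemma expect_ge0 P f : (forall a, 0 <= P a) -> (forall a, 0 <= f a) -> 0 <= \E_(a <- P) f a.
Proof. by move=> P0 f0; apply: sumR_ge0 => a _; apply: Rmult_le_pos. Qed.

Lemma leR_expect P f g : (forall a, 0 <= P a) -> (forall a, f a <= g a) ->
  \E_(a <- P) f a <= \E_(a <- P) g a.
Proof. by move=> P0 fg; apply: leR_sum => a _; apply: Rmult_le_compat_l. Qed.

Lemma expectD P f g : \E_(a <- P) (f a + g a) = \E_(a <- P) f a + \E_(a <- P) g a.
Proof. by rewrite -big_split; apply: eq_bigr => a _; rewrite Rmult_plus_distr_l. Qed.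

Lemma expectN P f : \E_(a <- P) - f a = - \E_(a <- P) f a.
Proof. by rewrite -sumRN; apply: eq_bigr => a _; ring. Qed.

Lemma expectMl P x f : \E_(a <- P) (x * f a) = x * \E_(a <- P) f a.
Proof. by rewrite /expect -sumR_mull; apply: eq_bigr => a _; ring. Qed.

Lemma expectMr P x f : \E_(a <- P) (f a * x) = (\E_(a <- P) f a) * x.
Proof. by rewrite /expect -sumR_mulr; apply: eq_bigr => a _; ring. Qed.

Lemma expect_sum (I : finType) (Q : pred I) P (F : I -> A -> R) :
  \E_(a <- P) (\sum_(i | Q i) F i a) = \sum_(i | Q i) \E_(a <- P) F i a.
Proof. by rewrite [RHS]exchange_big; apply: eq_bigr => a _; rewrite sumR_mull. Qed.

Lemma expect_const P x : is_pmf P -> \E_(a <- P) x = x.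
Proof. by move=> HP; rewrite /expect sumR_mulr pmf_sum1 // Rmult_1_l. Qed.

Lemma expect_exchange P (Q : B -> R) (F : A -> B -> R) :
  \E_(a <- P) \E_(b <- Q) F a b = \E_(b <- Q) \E_(a <- P) F a b.
Proof. by rewrite expect_sum; apply: eq_bigr => b _; rewrite expectMl. Qed.

Lemma exists_le_expect P f x : is_pmf P -> \E_(a <- P) f a <= x -> exists a, f a <= x.
Proof.
move=> HP fx; have P0 := pmf_ge0 HP; apply: contrapT => none.
have gap a : 0 < f a - x.
  by case: (Rle_lt_dec (f a) x) => [fa|]; [case: none; exists a | lra].
have gap0 a : 0 <= P a * (f a - x) by apply: Rmult_le_pos => //; apply/Rlt_le.
have mean_gap : \sum_a P a * (f a - x) = \E_(a <- P) f a - x.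
  by rewrite -{2}(expect_const x HP) -sumRB; apply: eq_bigr => a _; ring.
have no_gap : \sum_a P a * (f a - x) = 0.
  by have : 0 <= \sum_a P a * (f a - x) := sumR_ge0 (fun a _ => gap0 a); lra.
have P_null a : P a = 0.
  by have /Rmult_integral[] := sumR_eq0 gap0 no_gap a; have := gap a; lra.
by have := pmf_sum1 HP; rewrite big1 //; lra.
Qed.

End Expectation.

Definition stochastic (A B : finType) (V : A -> B -> R) : Prop := forall a, is_pmf (V a).

Definition output (A B : finType) (P : A -> R) (V : A -> B -> R) (b : B) : R :=
  \E_(a <- P) V a b.

Definition joint_law (A B : finType) (P : A -> R) (V : A -> B -> R) (w : A * B) : R :=
  P w.1 * V w.1 w.2.

Definition image_law (A B : finType) (f : A -> B) (P : A -> R) (b : B) : R :=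
  \sum_(a | f a == b) P a.

Section Kernels.
Variables (A B : finType) (P : A -> R) (V : A -> B -> R).

Lemma expect_output f : \E_(b <- output P V) f b = \E_(a <- P) \E_(b <- V a) f b.
Proof. by rewrite expect_sum; apply: eq_bigr => b _; rewrite -expectMr. Qed.

Lemma expect_joint f : \E_(w <- joint_law P V) f w = \E_(a <- P) \E_(b <- V a) f (a, b).
Proof.
rewrite /expect sumR_pair; apply: eq_bigr => a _; rewrite -sumR_mull.
by apply: eq_bigr => b _; rewrite /joint_law Rmult_assoc.
Qed.

Lemma output_ge0 : (forall a, 0 <= P a) -> stochastic V -> forall b, 0 <= output P V b.
Proof. by move=> P0 HV b; apply: expect_ge0 => // a; apply: pmf_ge0. Qed.

Lemma output_mass : stochastic V -> \sum_b output P V b = \sum_a P a.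
Proof.
by move=> HV; rewrite -expect_sum; apply: eq_bigr => a _; rewrite pmf_sum1 // Rmult_1_r.
Qed.

Lemma pmf_output : is_pmf P -> stochastic V -> is_pmf (output P V).
Proof.
move=> [P0 P1] HV; split; first exact: output_ge0.
by rewrite /rsum output_mass.
Qed.

Lemma pmf_joint : is_pmf P -> stochastic V -> is_pmf (joint_law P V).
Proof.
move=> [P0 P1] HV; split=> [w|]; first by apply: Rmult_le_pos => //; apply: pmf_ge0.
rewrite -P1 /rsum sumR_pair; apply: eq_bigr => a _.
by rewrite /joint_law /= sumR_mull pmf_sum1 // Rmult_1_r.
Qed.

Lemma image_law_ge0 (f : A -> B) b : (forall a, 0 <= P a) -> 0 <= image_law f P b.
Proof. by move=> P0; apply: sumR_ge0. Qed.

Lemma expect_image (f : A -> B) g : \E_(b <- image_law f P) g b = \E_(a <- P) g (f a).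
Proof.
rewrite /expect [RHS](sumR_fiber f); apply: eq_bigr => b _; rewrite -sumR_mulr.
by apply: eq_bigr => a /eqP ->.
Qed.

End Kernels.

Lemma stochastic_output (A B C : finType) (Q : A -> B -> R) (V : B -> C -> R) :
  stochastic Q -> stochastic V -> stochastic (fun a => output (Q a) V).
Proof. by move=> HQ HV a; apply: pmf_output. Qed.

(** * Product laws *)

Definition prod_law (I T : finType) (mu : I -> T -> R) (f : {ffun I -> T}) : R :=
  \prod_i mu i (f i).

Definition iid (I T : finType) (P : T -> R) : {ffun I -> T} -> R := prod_law (fun=> P).

Definition memoryless (I A B : finType) (V : A -> B -> R) (x : {ffun I -> A}) :
    {ffun I -> B} -> R :=
  prod_law (fun i => V (x i)).

Definition upd (I T : finType) (f : {ffun I -> T}) (i : I) (z : T) : {ffun I -> T} :=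
  [ffun k => if k == i then z else f k].

Section Update.
Variables (I T : finType).
Implicit Types (f : {ffun I -> T}).

Lemma upd_eq f i z : upd f i z i = z.
Proof. by rewrite ffunE eqxx. Qed.

Lemma upd_neq f i z k : k != i -> upd f i z k = f k.
Proof. by rewrite ffunE => /negbTE ->. Qed.

Lemma upd_swap f i i' z z' : i != i' -> upd (upd f i z) i' z' = upd (upd f i' z') i z.
Proof.
move=> ii'; apply/ffunP => k; rewrite !ffunE.
by case: (eqVneq k i') => // ->; rewrite eq_sym (negbTE ii').
Qed.

End Update.

Section ProductLaw.
Variables (I T : finType) (mu : I -> T -> R).

Lemma prod_law_ge0 f : (forall i t, 0 <= mu i t) -> 0 <= prod_law mu f.
Proof. by move=> mu0; apply: prodR_ge0. Qed.

Lemma expect_prod_law_prod (g : I -> T -> R) :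
  \E_(f <- prod_law mu) \prod_i g i (f i) = \prod_i \E_(t <- mu i) g i t.
Proof. by rewrite [RHS]bigA_distr_bigA; apply: eq_bigr => f _; rewrite -big_split. Qed.

Lemma prod_law_mass : \sum_f prod_law mu f = \prod_i \sum_t mu i t.
Proof. by rewrite [RHS]bigA_distr_bigA. Qed.

Hypothesis Hmu : stochastic mu.

Lemma pmf_prod_law : is_pmf (prod_law mu).
Proof.
split=> [f|]; first by apply: prod_law_ge0 => i; apply: pmf_ge0.
by rewrite /rsum prod_law_mass big1 // => i _; apply: pmf_sum1.
Qed.

(* The map exchanging [f i] with a fresh sample [b] is a measure-preserving involution. *)
Lemma expect_resample i (F : {ffun I -> T} -> T -> R) :
  (forall f z b, F (upd f i z) b = F f b) ->
  \E_(f <- prod_law mu) F f (f i) = \E_(f <- prod_law mu) \E_(b <- mu i) F f b.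
Proof.
move=> Fi; pose swap (w : {ffun I -> T} * T) := (upd w.1 i w.2, w.1 i).
have swapK : involutive swap.
  case=> f b; rewrite /swap /= upd_eq; congr pair.
  by apply/ffunP => k; rewrite !ffunE; case: eqP => // ->.
transitivity (\E_(w <- joint_law (prod_law mu) (fun=> mu i)) F w.1 (w.1 i)).
  by rewrite expect_joint; apply: eq_expect => f; rewrite /= expect_const.
rewrite -(expect_joint (prod_law mu) (fun=> mu i) (fun w => F w.1 w.2)).
rewrite /expect [LHS](reindex_inj (inv_inj swapK)).
apply: eq_bigr => -[f b] _; rewrite /joint_law /prod_law /= upd_eq Fi; congr (_ * _).
rewrite (bigD1 i) //= [in RHS](bigD1 i) //= upd_eq.
have -> : \big[Rmult/1]_(k | k != i) mu k (upd f i b k) =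
          \big[Rmult/1]_(k | k != i) mu k (f k).
  by apply: eq_bigr => k ki; rewrite upd_neq.
ring.
Qed.

Lemma expect_prod_law1 i (g : T -> R) : \E_(f <- prod_law mu) g (f i) = \E_(t <- mu i) g t.
Proof.
by rewrite (@expect_resample i (fun _ b => g b)) //= (expect_const _ pmf_prod_law).
Qed.

Lemma expect_prod_law2 i i' (g : T -> T -> R) : i != i' ->
  \E_(f <- prod_law mu) g (f i) (f i') = \E_(t <- mu i) \E_(t' <- mu i') g t t'.
Proof.
move=> ii'; rewrite (@expect_resample i (fun f b => g b (f i'))); last first.
  by move=> f z b; rewrite upd_neq // eq_sym.
by rewrite expect_exchange; apply: eq_expect => t; rewrite (expect_prod_law1 i' (g t)).
Qed.

End ProductLaw.

Lemma pmf_iid (I T : finType) (P : T -> R) : is_pmf P -> is_pmf (@iid I T P).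
Proof. by move=> HP; apply: pmf_prod_law. Qed.

Lemma stochastic_memoryless (I A B : finType) (V : A -> B -> R) :
  stochastic V -> stochastic (@memoryless I A B V).
Proof. by move=> HV x; apply: pmf_prod_law. Qed.

Lemma output_prod_law (I A B : finType) (mu : I -> A -> R) (V : A -> B -> R) y :
  output (prod_law mu) (memoryless V) y = prod_law (fun i => output (mu i) V) y.
Proof. exact: (expect_prod_law_prod mu (fun i x => V x (y i))). Qed.

Lemma prod_law_image (I T T' : finType) (mu : I -> T -> R) (h : T -> T') g :
  image_law (fun f : {ffun I -> T} => [ffun i => h (f i)]) (prod_law mu) g =
  prod_law (fun i => image_law h (mu i)) g.
Proof.
rewrite /prod_law; under [RHS]eq_bigr => i _ do rewrite /image_law big_mkcond.
rewrite bigA_distr_bigA /image_law big_mkcond; apply: eq_bigr => f _.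
case: eqP => [<-|hf]; first by apply: eq_bigr => i _; rewrite ffunE eqxx.
have [i hfi] : exists i, h (f i) != g i.
  apply/existsP; apply: contraT; rewrite negb_exists => /forallP hf_eq; case: hf.
  by apply/ffunP => i; rewrite ffunE; apply/eqP; have := hf_eq i; rewrite negbK.
by rewrite (@prodR_eq0 _ _ i) //= (negbTE hfi).
Qed.

(** * Logarithms and divergence *)

Definition xlog (x : R) : R := x * log2 x.

Lemma ln2_gt0 : 0 < ln 2.
Proof. by rewrite -ln_1; apply: ln_increasing; lra. Qed.

Lemma log2_1 : log2 1 = 0.
Proof. by rewrite /log2 ln_1 /Rdiv Rmult_0_l. Qed.

Lemma log2_2 : log2 2 = 1.
Proof. by rewrite /log2; have := ln2_gt0 => ?; field; lra. Qed.

Lemma log2_mult x y : 0 < x -> 0 < y -> log2 (x * y) = log2 x + log2 y.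
Proof. by move=> x0 y0; rewrite /log2 ln_mult // Rdiv_plus_distr. Qed.

Lemma log2_inv x : 0 < x -> log2 (/ x) = - log2 x.
Proof. by move=> x0; rewrite /log2 ln_Rinv // Ropp_div. Qed.

Lemma log2_div x y : 0 < x -> 0 < y -> log2 (x / y) = log2 x - log2 y.
Proof. by move=> x0 y0; rewrite log2_mult ?log2_inv //; apply: Rinv_0_lt_compat. Qed.

Lemma log2_le x y : 0 < x -> x <= y -> log2 x <= log2 y.
Proof.
move=> x0 xy; apply: Rmult_le_compat_r; first exact/Rlt_le/Rinv_0_lt_compat/ln2_gt0.
by case: xy => [xy|->]; [apply/Rlt_le/ln_increasing | lra].
Qed.

Lemma log2_Rpower x : log2 (Rpower 2 x) = x.
Proof. by rewrite /log2 /Rpower ln_exp; have := ln2_gt0 => ?; field; lra. Qed.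

Lemma log2_prod (I : finType) (v : I -> R) : (forall i, 0 < v i) ->
  log2 (\prod_i v i) = \sum_i log2 (v i).
Proof.
move=> v0; suff [] : 0 < \prod_i v i /\ log2 (\prod_i v i) = \sum_i log2 (v i) by [].
apply: (big_ind2 (fun x y => 0 < x /\ log2 x = y)) => [|x1 x2 y1 y2 [x1p <-] [y1p <-]|i _] //.
- by rewrite log2_1; split; lra.
- by split; [apply: Rmult_lt_0_compat | rewrite log2_mult].
Qed.

Lemma xlog0 : xlog 0 = 0.
Proof. by rewrite /xlog Rmult_0_l. Qed.

Lemma xlog1 : xlog 1 = 0.
Proof. by rewrite /xlog log2_1; lra. Qed.

Lemma xlogM x y : 0 <= x -> 0 <= y -> xlog (x * y) = y * xlog x + x * xlog y.
Proof.
rewrite /xlog; case=> [x0|<-]; last by rewrite Rmult_0_l; lra.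
case=> [y0|<-]; last by rewrite Rmult_0_r; lra.
by rewrite log2_mult //; ring.
Qed.

Lemma ln_le_sub1 x : 0 < x -> ln x <= x - 1.
Proof. by move=> x0; have := exp_ineq1_le (ln x); rewrite exp_ln //; lra. Qed.

Lemma plogqE p q : plogq p q = p * log2 (p / q).
Proof. by rewrite /plogq; case: Req_dec_T => [p0|_] /=; rewrite ?p0; lra. Qed.

Lemma plogq_ge p q : 0 <= p -> 0 <= q -> (q = 0 -> p = 0) -> (p - q) / ln 2 <= plogq p q.
Proof.
have ln2p := Rinv_0_lt_compat _ ln2_gt0; rewrite plogqE.
case=> [p0|<-] q0 pq; last by rewrite Rmult_0_l /Rdiv; nra.
have {}q0 : 0 < q by case: q0 => // q0; have := pq (esym q0); lra.
have -> : p * log2 (p / q) = - (p * ln (q / p)) / ln 2.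
  by rewrite log2_div // /log2 /Rdiv ln_mult ?ln_Rinv //; [ring | apply: Rinv_0_lt_compat].
apply: Rmult_le_compat_r; first lra.
have ln_qp := ln_le_sub1 (Rdiv_lt_0_compat _ _ q0 p0).
have : p * ln (q / p) <= p * (q / p - 1) by apply: Rmult_le_compat_l; lra.
have -> : p * (q / p - 1) = q - p by field; lra.
lra.
Qed.

Definition divergence (A : finType) (p q : A -> R) : R := \sum_a plogq (p a) (q a).

Lemma divergence_ge0 (A : finType) (p q : A -> R) :
  (forall a, 0 <= p a) -> (forall a, 0 <= q a) -> (forall a, q a = 0 -> p a = 0) ->
  \sum_a q a <= \sum_a p a -> 0 <= divergence p q.
Proof.
move=> p0 q0 pq le_qp; apply: (@Rle_trans _ (\sum_a (p a - q a) / ln 2)).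
  rewrite sumR_mulr sumRB; apply: Rmult_le_pos; first lra.
  exact/Rlt_le/Rinv_0_lt_compat/ln2_gt0.
by apply: leR_sum => a _; apply: plogq_ge (pq a).
Qed.

Section Marginals.
Variables (A B : finType) (p : A -> B -> R).
Hypothesis p0 : forall a b, 0 <= p a b.

Local Notation row a := (\sum_b p a b).
Local Notation col b := (\sum_a p a b).
Local Notation mass := (\sum_a \sum_b p a b).

Let row_ge0 a : 0 <= row a.
Proof. exact: sumR_ge0. Qed.

Let col_ge0 b : 0 <= col b.
Proof. exact: sumR_ge0. Qed.

Let le_row a b : p a b <= row a.
Proof. exact: (leR_sum_term b (p0 a)). Qed.

Let le_col a b : p a b <= col b.
Proof. exact: (leR_sum_term a (fun a => p0 a b)). Qed.

Let row_le_mass a : row a <= mass.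
Proof. exact: (leR_sum_term a row_ge0). Qed.

Lemma sum_plogq_marginals k : (0 < mass -> 0 < k) ->
  \sum_a \sum_b plogq (p a b) (row a * col b / k) =
  \sum_a \sum_b xlog (p a b) - \sum_a xlog (row a) - \sum_b xlog (col b) + mass * log2 k.
Proof.
move=> k0.
have -> : \sum_a xlog (row a) = \sum_a \sum_b p a b * log2 (row a).
  by apply: eq_bigr => a _; rewrite sumR_mulr.
have -> : \sum_b xlog (col b) = \sum_a \sum_b p a b * log2 (col b).
  by rewrite exchange_big; apply: eq_bigr => b _; rewrite sumR_mulr.
have -> : mass * log2 k = \sum_a \sum_b p a b * log2 k.
  by rewrite -sumR_mulr; apply: eq_bigr => a _; rewrite sumR_mulr.
rewrite -!sumRB -big_split; apply: eq_bigr => a _; rewrite -!sumRB -big_split.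
apply: eq_bigr => b _ /=; rewrite plogqE /xlog.
case: (p0 a b) => [pab|<-]; last by rewrite !Rmult_0_l; lra.
have pa := le_row a b; have pb := le_col a b; have am := row_le_mass a.
have {}k0 : 0 < k by apply: k0; lra.
have ab0 : 0 < row a * col b by apply: Rmult_lt_0_compat; lra.
by rewrite log2_div ?log2_div ?log2_mult //; try lra; apply: Rdiv_lt_0_compat.
Qed.

(* Non-negativity of mutual information, for measures of arbitrary mass. *)
Lemma sum_xlog_marginals_le :
  \sum_a xlog (row a) + \sum_b xlog (col b) <= \sum_a \sum_b xlog (p a b) + xlog mass.
Proof.
have mass_col : mass = \sum_b col b by rewrite exchange_big.
have mass0 : 0 <= mass by apply: sumR_ge0 => a _; apply: row_ge0.
have inv0 : 0 <= / mass.
  by case: mass0 => [m0|<-]; [apply/Rlt_le/Rinv_0_lt_compat | rewrite Rinv_0; lra].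
have q0 a b : 0 <= row a * col b / mass.
  by apply: Rmult_le_pos => //; apply: Rmult_le_pos; [apply: row_ge0 | apply: col_ge0].
have dominated (ab : A * B) : row ab.1 * col ab.2 / mass = 0 -> p ab.1 ab.2 = 0.
  case: ab => a b /=; have := p0 a b; have := le_row a b; have := le_col a b.
  have := row_le_mass a => am bm rm pab; case: mass0 => [m0|m0]; last lra.
  case/Rmult_integral=> [/Rmult_integral[]|inv_mass]; try lra.
  by have := Rinv_neq_0_compat mass; lra.
have same_mass : \sum_(ab : A * B) row ab.1 * col ab.2 / mass = mass.
  rewrite sumR_pair /= -[RHS]Rmult_1_r.
  transitivity (mass * mass * / mass); last first.
    by case: mass0 => [m0|<-]; [field; lra | rewrite !Rmult_0_l].
  rewrite {3}mass_col -!sumR_mulr; apply: eq_bigr => a _; rewrite -sumR_mull -sumR_mulr.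
  by apply: eq_bigr.
have := divergence_ge0 (fun ab => p0 ab.1 ab.2) (fun ab => q0 ab.1 ab.2) dominated.
rewrite same_mass /divergence !sumR_pair /= sum_plogq_marginals // -/(xlog mass).
by move/(_ (Rle_refl _)); lra.
Qed.

End Marginals.

Lemma mutinfE (A B : finType) (p : A -> B -> R) : (forall a b, 0 <= p a b) ->
  mutinf p = \sum_a \sum_b xlog (p a b) - \sum_a xlog (\sum_b p a b)
             - \sum_b xlog (\sum_a p a b).
Proof.
move=> p0; have := sum_plogq_marginals p0 (k := 1); rewrite log2_1 Rmult_0_r Rplus_0_r => <-.
  by apply: eq_bigr => a _; apply: eq_bigr => b _; rewrite Rdiv_1_r.
by move=> _; lra.
Qed.

Lemma cmutinfE (C A B : finType) (p : C -> A -> B -> R) : (forall c a b, 0 <= p c a b) ->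
  cmutinf p = \sum_c (\sum_a \sum_b xlog (p c a b) - \sum_a xlog (\sum_b p c a b)
             - \sum_b xlog (\sum_a p c a b) + xlog (\sum_a \sum_b p c a b)).
Proof. by move=> p0; apply: eq_bigr => c _; rewrite -sum_plogq_marginals. Qed.

(** * Output entropy of a channel *)

Definition mixture (T X : finType) (p : T -> X -> R) (x : X) : R := \sum_t p t x.

Lemma mixture_ge0 (T X : finType) (p : T -> X -> R) :
  (forall t x, 0 <= p t x) -> forall x, 0 <= mixture p x.
Proof. by move=> p0 x; apply: sumR_ge0. Qed.

Lemma mixture_mass (T X : finType) (p : T -> X -> R) :
  \sum_x mixture p x = \sum_t \sum_x p t x.
Proof. by rewrite [RHS]exchange_big. Qed.

Lemma expect_mixture (T X : finType) (p : T -> X -> R) f :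
  \E_(x <- mixture p) f x = \sum_t \E_(x <- p t) f x.
Proof. by rewrite [RHS]exchange_big; apply: eq_bigr => x _; rewrite sumR_mulr. Qed.

Lemma output_mixture (T X B : finType) (p : T -> X -> R) (V : X -> B -> R) b :
  output (mixture p) V b = \sum_t output (p t) V b.
Proof. exact: expect_mixture. Qed.

Lemma pmf_mixture (T X : finType) (p : T -> X -> R) : is_pmf2 p -> is_pmf (mixture p).
Proof. by case=> p0 p1; split; [apply: mixture_ge0 | rewrite -p1; apply: mixture_mass]. Qed.

(* For an input measure [q] of total mass [m]: [m] times the output entropy of the normalization
   of [q]. *)
Definition out_entropy (X B : finType) (V : X -> B -> R) (q : X -> R) : R :=
  xlog (\sum_x q x) - \sum_b xlog (output q V b).

Definition noise_entropy (X B : finType) (V : X -> B -> R) (x : X) : R :=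
  - \sum_b xlog (V x b).

Definition mix_info (X B T : finType) (V : X -> B -> R) (p : T -> X -> R) : R :=
  out_entropy V (mixture p) - \sum_t out_entropy V (p t).

Definition in_info (X B : finType) (V : X -> B -> R) (q : X -> R) : R :=
  out_entropy V q - \E_(x <- q) noise_entropy V x.

Lemma mix_info_in_info (X B T : finType) (V : X -> B -> R) (p : T -> X -> R) :
  mix_info V p + \sum_t in_info V (p t) = in_info V (mixture p).
Proof. by rewrite /in_info sumRB expect_mixture /mix_info; ring. Qed.

Section OutputEntropy.
Variables (X B : finType) (V : X -> B -> R).
Hypothesis HV : stochastic V.

Lemma eq_out_entropy (q q' : X -> R) : (forall x, q x = q' x) ->
  out_entropy V q = out_entropy V q'.
Proof. by move=> /funext ->. Qed.

Lemma out_entropyZ k (q : X -> R) : 0 <= k -> (forall x, 0 <= q x) ->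
  out_entropy V (fun x => k * q x) = k * out_entropy V q.
Proof.
move=> k0 q0; have xlogZ r : 0 <= r -> xlog (k * r) = r * xlog k + k * xlog r by apply: xlogM.
have outZ b : xlog (output (fun x => k * q x) V b) =
    output q V b * xlog k + k * xlog (output q V b).
  rewrite -xlogZ; last exact: output_ge0.
  by congr xlog; rewrite /output /expect -sumR_mull; apply: eq_bigr => x _; ring.
rewrite /out_entropy sumR_mull xlogZ; last exact: sumR_ge0.
rewrite (eq_bigr _ (fun b _ => outZ b)) big_split /= sumR_mulr sumR_mull output_mass //.
ring.
Qed.

Lemma out_entropy0 (q : X -> R) : (forall x, q x = 0) -> out_entropy V q = 0.
Proof.
move=> q0; rewrite (@eq_out_entropy q (fun x => 0 * q x)); last by move=> x; rewrite q0 Rmult_0_l.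
by rewrite out_entropyZ ?Rmult_0_l //; [lra | move=> x; rewrite q0; lra].
Qed.

Lemma sum_out_entropy_le_mixture (T : finType) (p : T -> X -> R) :
  (forall t x, 0 <= p t x) -> \sum_t out_entropy V (p t) <= out_entropy V (mixture p).
Proof.
move=> p0; rewrite /out_entropy sumRB mixture_mass.
have := @sum_xlog_marginals_le T B (fun t => output (p t) V) (fun t => output_ge0 (p0 t) HV).
have massE t : \sum_b output (p t) V b = \sum_x p t x by apply: output_mass.
under eq_bigr => t _ do rewrite massE.
under [X in _ <= _ + xlog X -> _]eq_bigr => t _ do rewrite massE.
under [X in _ -> _ <= _ - X]eq_bigr => b _ do rewrite output_mixture.
by lra.
Qed.

Lemma mix_info_ge0 (T : finType) (p : T -> X -> R) :
  (forall t x, 0 <= p t x) -> 0 <= mix_info V p.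
Proof. by move=> p0; have := sum_out_entropy_le_mixture p0; rewrite /mix_info; lra. Qed.

Lemma sum_xlog_joint (q : X -> R) : (forall x, 0 <= q x) ->
  \sum_x \sum_b xlog (q x * V x b) = \sum_x xlog (q x) - \E_(x <- q) noise_entropy V x.
Proof.
move=> q0; rewrite -sumRB; apply: eq_bigr => x _; have [V0 V1] := HV x.
under eq_bigr => b _ do rewrite xlogM //.
by rewrite big_split /= sumR_mulr sumR_mull /noise_entropy [\sum_b V x b]V1; ring.
Qed.

Lemma in_info_ge0 (q : X -> R) : (forall x, 0 <= q x) -> 0 <= in_info V q.
Proof.
move=> q0; rewrite /in_info /out_entropy.
have := @sum_xlog_marginals_le X B (fun x b => q x * V x b)
  (fun x b => Rmult_le_pos _ _ (q0 x) (pmf_ge0 (HV x) b)).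
have massE x : \sum_b q x * V x b = q x by rewrite sumR_mull pmf_sum1 // Rmult_1_r.
rewrite sum_xlog_joint //; under eq_bigr => x _ do rewrite massE.
by under [X in _ <= _ + xlog X -> _]eq_bigr => x _ do rewrite massE; rewrite /output /expect; lra.
Qed.

Lemma out_entropy_point (x : X) (q : X -> R) : (forall x', 0 <= q x') ->
  (forall x', x' != x -> q x' = 0) -> out_entropy V q = \E_(x' <- q) noise_entropy V x'.
Proof.
move=> q0 qx; have [V0 V1] := HV x.
have atx (F : X -> R) : \E_(x' <- q) F x' = q x * F x.
  by rewrite /expect (bigD1 x) //= big1 ?Rplus_0_r // => x' /qx ->; rewrite Rmult_0_l.
have mass_x : \sum_x' q x' = q x.
  by rewrite -[RHS]Rmult_1_r -(atx (fun=> 1)) /expect sumR_mulr Rmult_1_r.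
rewrite /out_entropy mass_x atx /noise_entropy /output.
under eq_bigr => b _ do rewrite atx xlogM //.
by rewrite big_split /= sumR_mulr sumR_mull [\sum_b V x b]V1; ring.
Qed.

Lemma mix_infoZ (T : finType) k (p : T -> X -> R) : 0 <= k -> (forall t x, 0 <= p t x) ->
  mix_info V (fun t x => k * p t x) = k * mix_info V p.
Proof.
move=> k0 p0; rewrite /mix_info Rmult_minus_distr_l -sumR_mull -out_entropyZ //; last first.
  exact: mixture_ge0.
congr (_ - _); last by apply: eq_bigr => t _; rewrite out_entropyZ.
by apply: eq_out_entropy => x; rewrite /mixture sumR_mull.
Qed.

Lemma in_infoZ k (q : X -> R) : 0 <= k -> (forall x, 0 <= q x) ->
  in_info V (fun x => k * q x) = k * in_info V q.
Proof.
move=> k0 q0; rewrite /in_info out_entropyZ // Rmult_minus_distr_l /expect -sumR_mull.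
by congr (_ - _); apply: eq_bigr => x _; ring.
Qed.

Lemma mix_info0 (T : finType) (p : T -> X -> R) : (forall t x, p t x = 0) -> mix_info V p = 0.
Proof.
move=> p0; rewrite /mix_info out_entropy0 => [|x]; last by apply: big1 => t _.
by rewrite big1 => [|t _]; [lra | apply: out_entropy0].
Qed.

Lemma in_info0 (q : X -> R) : (forall x, q x = 0) -> in_info V q = 0.
Proof.
by move=> q0; rewrite /in_info out_entropy0 // /expect big1 => [|x _]; rewrite ?q0; lra.
Qed.

End OutputEntropy.

(** * Carathéodory's theorem for cones *)

Lemma linear_dependence (U I : finType) (S : {set U}) (a : U -> I -> R) :
  (#|I| < #|S|)%N ->
  exists c : U -> R, [/\ forall u, u \notin S -> c u = 0, exists u, 0 < c u &
    forall i, \sum_u c u * a u i = 0].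
Proof.
move=> ltIS; pose A : 'M[R]_(#|S|, #|I|) := (\matrix_(s, i) a (enum_val s) (enum_val i))%R.
have /rowV0Pn [v vK v_neq0] : kermx A != 0%R.
  by rewrite -mxrank_eq0 mxrank_ker subn_eq0 -ltnNge (leq_ltn_trans (rank_leq_col A)).
have {}vK : (v *m A = 0)%R by apply/sub_kermxP.
have [s0 vs0] : exists s, v ord0 s != 0%R.
  by apply/existsP; apply: contraNT v_neq0 => /existsPn v0; apply/eqP/rowP => s;
    rewrite mxE; apply/eqP; have := v0 s; rewrite negbK.
pose c u := \sum_s (if enum_val s == u then v ord0 s0 * v ord0 s else 0).
have c_enum s : c (enum_val s) = v ord0 s0 * v ord0 s.
  rewrite /c (bigD1 s) //= eqxx big1 ?Rplus_0_r // => s' ss'.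
  by rewrite (inj_eq enum_val_inj) (negbTE ss').
exists c; split=> [u uS||i].
- by apply: big1 => s _; case: eqP => // us; move: uS; rewrite -us enum_valP.
- by exists (enum_val s0); rewrite c_enum; apply/Rsqr_pos_lt/eqP.
have := congr1 (fun M : 'M[R]_(1, #|I|) => v ord0 s0 * M ord0 (enum_rank i)) vK.
rewrite !mxE Rmult_0_r => v_rel; rewrite -[RHS]v_rel big_distrr /=.
under eq_bigr => u _ do rewrite -sumR_mulr.
rewrite exchange_big; apply: eq_bigr => s _.
rewrite (bigD1 (enum_val s)) //= eqxx big1 ?Rplus_0_r => [|u us]; last first.
  by rewrite eq_sym (negbTE us) Rmult_0_l.
by rewrite mxE enum_rankK Rmult_assoc.
Qed.

Definition supp (U : finType) (w : U -> R) : {set U} := [set u | w u != 0].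

Lemma shrink_support (U I : finType) (a : U -> I -> R) (w : U -> R) :
  (forall u, 0 <= w u) -> (#|I| < #|supp w|)%N ->
  exists w' : U -> R, [/\ forall u, 0 <= w' u, supp w' \proper supp w &
    forall i, \sum_u w' u * a u i = \sum_u w u * a u i].
Proof.
move=> w0 /(linear_dependence a) [c [c_supp [u0 cu0] c_rel]].
have {}c_supp u : w u = 0 -> c u = 0 by move=> wu; apply: c_supp; rewrite inE wu eqxx.
have pos u : reflect (0 < c u) (0 < c u)%R by apply: RltP.
case: (@order.Order.TotalTheory.arg_minP _ _ _ u0 (fun u => 0 < c u)%R (fun u => w u / c u)).
  exact/pos.
move=> t /pos ct t_min; pose r := w t / c t.
have r0 : 0 <= r by apply: Rmult_le_pos => //; apply/Rlt_le/Rinv_0_lt_compat.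
have rt : w t - r * c t = 0 by rewrite /r; field; lra.
exists (fun u => w u - r * c u); split=> [u||i].
- case: (Rlt_le_dec 0 (c u)) => cu; last by have := w0 u; nra.
  have /RleP /(Rmult_le_compat_r (c u)) := t_min u (introT (pos u) cu).
  have -> : w u / c u * c u = w u by field; lra.
  by rewrite -/r; lra.
- apply/properP; split; first apply/subsetP => u; last exists t; rewrite !inE ?rt ?eqxx //.
    by apply: contra => /eqP wu; rewrite wu (c_supp _ wu) Rmult_0_r Rminus_diag.
  by apply/eqP => wt; move: ct; rewrite (c_supp _ wt); lra.
- under eq_bigr => u _ do rewrite Rmult_minus_distr_r Rmult_assoc.
  by rewrite sumRB sumR_mull c_rel; lra.
Qed.

Lemma conic_caratheodory (U I : finType) (a : U -> I -> R) (w : U -> R) :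
  (forall u, 0 <= w u) ->
  exists w' : U -> R, [/\ forall u, 0 <= w' u, (#|supp w'| <= #|I|)%N &
    forall i, \sum_u w' u * a u i = \sum_u w u * a u i].
Proof.
have [m] := ubnP #|supp w|; elim: m w => // m IH w; rewrite ltnS => wm w0.
case: (leqP #|supp w| #|I|) => [small|/(shrink_support a w0) [w' [w'0 /proper_card lt w'a]]].
  by exists w.
have [w'' [w''0 w''I w''a]] := IH w' (leq_trans lt wm) w'0.
by exists w''; split=> // i; rewrite w''a.
Qed.

Lemma sumR_onth (T : Type) (s : seq T) d (F : T -> R) : (size s <= d)%N ->
  \sum_(i < d) oapp F 0 (onth s i) = \sum_(x <- s) F x.
Proof.
elim: s d => [|x s IH] [|d] //= sd; last by rewrite big_ord_recl big_cons IH.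
  by rewrite big_ord0 big_nil.
by rewrite big_nil big1 // => i _; rewrite onth0n.
Qed.

Lemma sumR_supp (U : finType) (w F : U -> R) :
  \sum_(u <- enum (supp w)) w u * F u = \sum_u w u * F u.
Proof.
rewrite big_enum /= [RHS](bigID (mem (supp w))) /= [X in _ = _ + X]big1 ?Rplus_0_r // => u.
by rewrite inE negbK => /eqP ->; rewrite Rmult_0_l.
Qed.

Lemma reduce_alphabet (U X J : finType) (phi : J -> (X -> R) -> R) (p : U -> X -> R) :
  (forall j k q, 0 <= k -> (forall x, 0 <= q x) -> phi j (fun x => k * q x) = k * phi j q) ->
  (forall u x, 0 <= p u x) ->
  exists p' : 'I_(#|X| + #|J|) -> X -> R, [/\ forall u x, 0 <= p' u x,
    forall x, mixture p' x = mixture p x &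
    forall j, \sum_u phi j (p' u) = \sum_u phi j (p u)].
Proof.
move=> phiZ p0; pose feature u (i : X + J) :=
  match i with inl x => p u x | inr j => phi j (p u) end.
have [|w [w0 w_small w_sum]] := conic_caratheodory feature (w := fun=> 1); first by move=> u; lra.
have {}w_sum i : \sum_(u <- enum (supp w)) w u * feature u i = \sum_u feature u i.
  by rewrite sumR_supp w_sum; apply: eq_bigr => u _; rewrite Rmult_1_l.
rewrite card_sum cardE in w_small.
pose letter (k : 'I_(#|X| + #|J|)) := onth (enum (supp w)) k.
exists (fun k x => oapp (fun u => w u * p u x) 0 (letter k)); split=> [k x|x|j].
- by case: (letter k) => /= [u|]; [apply: Rmult_le_pos | lra].
- by rewrite /mixture sumR_onth // (w_sum (inl x)).
rewrite -(w_sum (inr j)) -(sumR_onth (fun u => w u * feature u (inr j)) w_small).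
apply: eq_bigr => k _.
rewrite /letter; case: onth => [u|] /=; first by rewrite phiZ.
transitivity (0 * phi j (fun=> 0)); last ring.
rewrite -phiZ => [||_]; try lra.
by congr (phi j); apply: funext => x; rewrite Rmult_0_l.
Qed.

(** * Sequences of reals *)

Lemma Un_cv_subseq (u : nat -> R) l (phi : nat -> nat) :
  (forall n, (n <= phi n)%N) -> Un_cv u l -> Un_cv (fun n => u (phi n)) l.
Proof.
move=> n_phi cv e e0; have [N HN] := cv e e0; exists N => n nN; apply: HN.
by apply/leP; apply: leq_trans (n_phi n); apply/leP.
Qed.

Lemma Un_cv_const x : Un_cv (fun=> x) x.
Proof. by move=> e e0; exists 0%N => n _; rewrite /Rdist Rminus_diag Rabs_R0. Qed.

Lemma Un_cv_mulr u l x : Un_cv u l -> Un_cv (fun n => u n * x) (l * x).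
Proof. by move=> cv; apply: CV_mult cv (Un_cv_const x). Qed.

Lemma Un_cv_sum (T : finType) (u : nat -> T -> R) (l : T -> R) :
  (forall t, Un_cv (fun n => u n t) (l t)) ->
  Un_cv (fun n => \sum_t u n t) (\sum_t l t).
Proof.
move=> cv; elim: (index_enum T) => [|t s IH].
  by rewrite big_nil; apply: Un_cv_ext (Un_cv_const 0) => n; rewrite big_nil.
by rewrite big_cons; apply: Un_cv_ext (CV_plus _ _ _ _ (cv t) IH) => n; rewrite big_cons.
Qed.

Lemma Un_cv_dominated0 (u v : nat -> R) N :
  (forall n, (N <= n)%N -> Rabs (u n) <= v n) -> Un_cv v 0 -> Un_cv u 0.
Proof.
move=> uv cv e e0; have [M HM] := cv e e0; exists (maxn N M) => n /leP; rewrite geq_max.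
case/andP=> Nn /leP Mn; have := HM n Mn; rewrite /Rdist !Rminus_0_r => /(Rle_lt_trans _ _ _).
by apply; apply: Rle_trans (uv n Nn) (Rle_abs _).
Qed.

Lemma Un_cv_inv_INR : Un_cv (fun n => / INR n) 0.
Proof.
apply: (@CV_shift _ 1%N); apply: Un_cv_ext RinvN_cv => n.
by rewrite plus_INR.
Qed.

Lemma Un_cv_ge u l x : Un_cv u l -> (forall n, x - / (INR n + 1) <= u n) -> x <= l.
Proof.
move=> cv; rewrite -[X in X <= l]Rminus_0_r => u_ge.
exact: Rle_cv_lim u_ge (CV_minus _ _ _ _ (Un_cv_const x) RinvN_cv) cv.
Qed.

Lemma cluster_subseq (u : nat -> R) a b : (forall n, a <= u n <= b) ->
  exists (phi : nat -> nat) (l : R), (forall n, (n <= phi n)%N) /\ Un_cv (fun n => u (phi n)) l.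
Proof.
move=> u_ab; have [l Hl] := Bolzano_Weierstrass u _ (compact_P3 a b) u_ab.
have close n : exists m, (n <= m)%N /\ Rabs (u m - l) < / (INR n + 1).
  have [|m [/leP nm u_m]] := Hl (disc l (RinvN n)) n; first by exists (RinvN n).
  by exists m.
have [phi phiP] := choice close; exists phi, l; split=> [n|]; first by case: (phiP n).
have cv0 : Un_cv (fun n => u (phi n) - l) 0.
  by apply: (@Un_cv_dominated0 _ _ 0) RinvN_cv => n _; apply/Rlt_le; case: (phiP n).
rewrite -[l]Rplus_0_l; apply: Un_cv_ext (CV_plus _ _ _ _ cv0 (Un_cv_const l)) => n /=; ring.
Qed.

Lemma cluster_subseq_fin (T : finType) (v : nat -> T -> R) a b :
  (forall n t, a <= v n t <= b) ->
  exists (phi : nat -> nat) (l : T -> R),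
    (forall n, (n <= phi n)%N) /\ forall t, Un_cv (fun n => v (phi n) t) (l t).
Proof.
move=> v_ab; suff [phi [l [n_phi cv]]] : exists (phi : nat -> nat) (l : T -> R),
    (forall n, (n <= phi n)%N) /\
    forall t, t \in enum T -> Un_cv (fun n => v (phi n) t) (l t).
  by exists phi, l; split=> // t; apply: cv; rewrite mem_enum.
elim: (enum T) => [|t0 s [phi [l [n_phi cv]]]].
  by exists id, (fun=> 0); split.
have [psi [lt0 [n_psi cvt0]]] := cluster_subseq (fun n => v_ab (phi n) t0).
exists (phi \o psi), (fun t => if t == t0 then lt0 else l t); split=> [n|t].
  exact: leq_trans (n_psi n) (n_phi _).
by rewrite inE; case: eqP => [->|_] //= ts; apply: (Un_cv_subseq n_psi (cv t ts)).
Qed.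

Lemma pmf2_cluster (U X : finType) (p : nat -> U -> X -> R) : (forall n, is_pmf2 (p n)) ->
  exists (phi : nat -> nat) (q : U -> X -> R), [/\ forall n, (n <= phi n)%N, is_pmf2 q &
    forall u x, Un_cv (fun n => p (phi n) u x) (q u x)].
Proof.
move=> Hp; have p01 n (t : U * X) : 0 <= p n t.1 t.2 <= 1.
  have [p0 <-] := Hp n; split=> //; apply: Rle_trans (leR_sum_term t.2 (p0 t.1)) _.
  by apply: (@leR_sum_term _ (fun u => \sum_x p n u x)) => u; apply: sumR_ge0.
have [phi [l [n_phi cv]]] := cluster_subseq_fin p01.
exists phi, (fun u x => l (u, x)); split=> [//||u x]; last exact: (cv (u, x)).
split=> [u x|].
  exact: Rle_cv_lim (fun n => proj1 (p01 (phi n) (u, x))) (Un_cv_const 0) (cv (u, x)).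
apply: (UL_sequence (fun n => \sum_u \sum_x p (phi n) u x)).
  by apply: Un_cv_sum => u; apply: Un_cv_sum => x; apply: (cv (u, x)).
by apply: Un_cv_ext (Un_cv_const 1) => n; case: (Hp (phi n)) => _ <-.
Qed.

Lemma xlog_sqrt_bound x : 0 <= x <= 1 -> Rabs (xlog x) <= 2 / ln 2 * sqrt x.
Proof.
case=> [[x0|<-] x1]; last by rewrite xlog0 sqrt_0 Rabs_R0; lra.
have s0 := sqrt_lt_R0 x x0; have ss := sqrt_sqrt x (Rlt_le _ _ x0).
have ln_x : - ln x = 2 * ln (/ sqrt x) by rewrite ln_Rinv // -{1}ss ln_mult //; ring.
have ln_x0 : ln x <= 0 by have := ln_le_sub1 x0; lra.
have -> : Rabs (xlog x) = x * - ln x * / ln 2.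
  rewrite /xlog /log2 /Rdiv -Rmult_assoc Rabs_mult [Rabs (/ _)]Rabs_right; last first.
    exact/Rle_ge/Rlt_le/Rinv_0_lt_compat/ln2_gt0.
  by rewrite Rabs_left1; [ring | nra].
have -> : 2 / ln 2 * sqrt x = sqrt x * sqrt x * (2 * / sqrt x) * / ln 2.
  by have := ln2_gt0 => ?; field; split; lra.
apply: Rmult_le_compat_r; first exact/Rlt_le/Rinv_0_lt_compat/ln2_gt0.
rewrite ss ln_x; have := ln_le_sub1 (Rinv_0_lt_compat _ s0) => ln_s.
by apply: Rmult_le_compat_l; lra.
Qed.

Lemma Un_cv_xlog u l : (forall n, 0 <= u n) -> Un_cv u l ->
  Un_cv (fun n => xlog (u n)) (xlog l).
Proof.
move=> u0 cv; case: (Rle_cv_lim u0 (Un_cv_const 0) cv) => [l0|l0].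
  apply: CV_mult => //; apply: Un_cv_mulr.
  by apply: (continuity_seq ln) => //; apply: derivable_continuous_pt; exists (/ l);
    apply: derivable_pt_lim_ln.
rewrite -l0 xlog0 in cv *; have [N HN] := cv 1 Rlt_0_1.
apply: (@Un_cv_dominated0 _ (fun n => 2 / ln 2 * sqrt (u n)) N) => [n /leP /HN|].
  rewrite /Rdist Rminus_0_r => /Rabs_def2 [u1 _]; apply: xlog_sqrt_bound.
  by split=> //; lra.
rewrite -(Rmult_0_r (2 / ln 2)) -sqrt_0; apply: CV_mult (Un_cv_const _) _.
by apply: continuity_seq cv; apply: continuity_pt_sqrt; lra.
Qed.

(** * Mutual informations as information functionals *)

Section MutualInformation.
Variables (X B : finType) (V : X -> B -> R).
Hypothesis HV : stochastic V.

Lemma mutinf_in_info (q : X -> R) : is_pmf q -> mutinf (fun x b => q x * V x b) = in_info V q.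
Proof.
case=> q0 q1; have massE x : \sum_b q x * V x b = q x by rewrite sumR_mull pmf_sum1 // Rmult_1_r.
rewrite mutinfE => [|x b]; last by apply: Rmult_le_pos => //; apply: pmf_ge0.
rewrite sum_xlog_joint //; under [X in _ - X - _]eq_bigr => x _ do rewrite massE.
by rewrite /in_info /out_entropy [\sum_x q x]q1 xlog1 /output /expect; ring.
Qed.

Lemma mutinf_mix_info (T : finType) (p : T -> X -> R) : is_pmf2 p ->
  mutinf (fun t => output (p t) V) = mix_info V p.
Proof.
move=> Hp; have [p0 p1] := Hp; rewrite mutinfE => [|t b]; last exact: output_ge0.
rewrite /mix_info /out_entropy sumRB (pmf_sum1 (pmf_mixture Hp)) xlog1.
under [X in _ - X - _]eq_bigr => t _ do rewrite output_mass //.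
by under [X in _ = _ - X - _]eq_bigr => b _ do rewrite output_mixture; ring.
Qed.

Lemma cmutinf_in_info (T : finType) (p : T -> X -> R) : (forall t x, 0 <= p t x) ->
  cmutinf (fun t x b => p t x * V x b) = \sum_t in_info V (p t).
Proof.
move=> p0; rewrite cmutinfE => [|t x b]; last by apply: Rmult_le_pos => //; apply: pmf_ge0.
apply: eq_bigr => t _.
have massE x : \sum_b p t x * V x b = p t x by rewrite sumR_mull pmf_sum1 // Rmult_1_r.
rewrite sum_xlog_joint //; under [X in _ - X - _ + _]eq_bigr => x _ do rewrite massE.
under [X in _ + xlog X]eq_bigr => x _ do rewrite massE.
by rewrite /in_info /out_entropy /output /expect; ring.
Qed.

End MutualInformation.

(** * The single-letter rate bounds form a closed set *)

Section InformationContinuity.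
Variables (X B : finType) (V : X -> B -> R).
Hypothesis HV : stochastic V.

Lemma Un_cv_mixture (T : finType) (p : nat -> T -> X -> R) (q : T -> X -> R) x :
  (forall t x, Un_cv (fun n => p n t x) (q t x)) ->
  Un_cv (fun n => mixture (p n) x) (mixture q x).
Proof. by move=> cv; apply: Un_cv_sum. Qed.

Lemma Un_cv_expect (f : X -> R) (p : nat -> X -> R) (q : X -> R) :
  (forall x, Un_cv (fun n => p n x) (q x)) ->
  Un_cv (fun n => \E_(x <- p n) f x) (\E_(x <- q) f x).
Proof. by move=> cv; apply: Un_cv_sum => x; apply: Un_cv_mulr. Qed.

Lemma Un_cv_out_entropy (p : nat -> X -> R) (q : X -> R) :
  (forall n x, 0 <= p n x) -> (forall x, Un_cv (fun n => p n x) (q x)) ->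
  Un_cv (fun n => out_entropy V (p n)) (out_entropy V q).
Proof.
move=> p0 cv; apply: CV_minus.
  by apply: Un_cv_xlog; [move=> n; apply: sumR_ge0 | apply: Un_cv_sum].
apply: Un_cv_sum => b; apply: Un_cv_xlog => [n|]; first exact: output_ge0.
exact: Un_cv_expect.
Qed.

Lemma Un_cv_in_info (p : nat -> X -> R) (q : X -> R) :
  (forall n x, 0 <= p n x) -> (forall x, Un_cv (fun n => p n x) (q x)) ->
  Un_cv (fun n => in_info V (p n)) (in_info V q).
Proof. by move=> p0 cv; apply: CV_minus; [apply: Un_cv_out_entropy | apply: Un_cv_expect]. Qed.

Lemma Un_cv_mix_info (T : finType) (p : nat -> T -> X -> R) (q : T -> X -> R) :
  (forall n t x, 0 <= p n t x) -> (forall t x, Un_cv (fun n => p n t x) (q t x)) ->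
  Un_cv (fun n => mix_info V (p n)) (mix_info V q).
Proof.
move=> p0 cv; apply: CV_minus.
  apply: Un_cv_out_entropy => [n|x]; [exact: mixture_ge0 | exact: Un_cv_mixture].
by apply: Un_cv_sum => t; apply: Un_cv_out_entropy.
Qed.

End InformationContinuity.

Section RateBounds.
Variables (J X : finType) (Y : J -> finType) (V : forall j, X -> Y j -> R).
Arguments V : clear implicits.
Hypothesis HV : forall j, stochastic (V j).
Variables (k s : J).

(* [r2] bounds the rate of the message of receiver [k], [r12] the sum rate. *)
Definition rate_bounds (U : finType) (p : U -> X -> R) (r2 r12 : R) : Prop :=
  [/\ r2 <= mix_info (V k) p,
      forall j, j != k -> r12 <= \sum_u in_info (V j) (p u) + mix_info (V k) p
    & r12 <= in_info (V s) (mixture p)].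

Lemma rate_bounds_le (U : finType) (p : U -> X -> R) r2 r12 r2' r12' :
  r2' <= r2 -> r12' <= r12 -> rate_bounds p r2 r12 -> rate_bounds p r2' r12'.
Proof. by move=> le2 le12 [b2 b12 bs]; split=> [|j jk|]; [|have := b12 j jk|]; lra. Qed.

Lemma rate_bounds_small_alphabet (U : finType) (p : U -> X -> R) r2 r12 :
  is_pmf2 p -> rate_bounds p r2 r12 ->
  exists p' : 'I_(#|X| + #|J|) -> X -> R, is_pmf2 p' /\ rate_bounds p' r2 r12.
Proof.
case=> p0 p1; have [p' [p'0 /funext mixE entE]] :=
  reduce_alphabet (fun j => @out_entropyZ _ _ _ (HV j)) p0.
have mix_infoE j : mix_info (V j) p' = mix_info (V j) p by rewrite /mix_info mixE entE.
have in_infoE j : \sum_u in_info (V j) (p' u) = \sum_u in_info (V j) (p u).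
  by have := mix_info_in_info (V j) p'; rewrite mix_infoE mixE -mix_info_in_info; lra.
move=> [b2 b12 bs]; exists p'; split.
  by split=> //; rewrite -p1 /rsum -mixture_mass mixE mixture_mass.
by split=> [|j jk|]; rewrite ?mix_infoE ?in_infoE ?mixE //; apply: b12.
Qed.

Lemma rate_bounds_closed r2 r12 :
  (forall d, 0 < d -> exists (U : finType) (p : U -> X -> R),
     is_pmf2 p /\ rate_bounds p (r2 - d) (r12 - d)) ->
  exists (U : finType) (p : U -> X -> R), is_pmf2 p /\ rate_bounds p r2 r12.
Proof.
move=> approx; have approx_n n : exists p : 'I_(#|X| + #|J|) -> X -> R,
    is_pmf2 p /\ rate_bounds p (r2 - / (INR n + 1)) (r12 - / (INR n + 1)).
  by have [U [p [Hp]]] := approx _ (RinvN_pos n); apply: rate_bounds_small_alphabet.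
have [P HP] := choice approx_n.
have [phi [p [n_phi Hp cv]]] := pmf2_cluster (fun n => proj1 (HP n)).
have P0 n u x : 0 <= P (phi n) u x by case: (HP (phi n)) => -[].
have slack n : / (INR (phi n) + 1) <= / (INR n + 1).
  apply: Rinv_le_contravar; first by have := pos_INR n; lra.
  by have := le_INR _ _ (elimT leP (n_phi n)); lra.
have bounds n : rate_bounds (P (phi n)) (r2 - / (INR n + 1)) (r12 - / (INR n + 1)).
  by apply: rate_bounds_le (proj2 (HP (phi n))); have := slack n; lra.
have cv_mix j := Un_cv_mix_info (HV j) P0 cv.
exists 'I_(#|X| + #|J|), p; split=> //; split=> [|j jk|].
- by apply: Un_cv_ge (cv_mix k) _ => n; case: (bounds n).
- have cv_in : Un_cv (fun n => \sum_u in_info (V j) (P (phi n) u)) (\sum_u in_info (V j) (p u)).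
    by apply: Un_cv_sum => u; apply: Un_cv_in_info.
  by apply: Un_cv_ge (CV_plus _ _ _ _ cv_in (cv_mix k)) _ => n; case: (bounds n) => _ /(_ j jk).
- have cv_s : Un_cv (fun n => in_info (V s) (mixture (P (phi n)))) (in_info (V s) (mixture p)).
    by apply: Un_cv_in_info => // [n|x]; [exact: mixture_ge0 | exact: Un_cv_mixture].
  by apply: Un_cv_ge cv_s _ => n; case: (bounds n).
Qed.

End RateBounds.

(** * Receivers of a broadcast channel *)

Section BroadcastChannel.
Variables (K : nat) (X : finType) (Y : 'I_K -> finType) (W : X -> outT Y -> R).
Hypothesis HW : is_channel W.

Lemma marg_image_law j x : marg W j x = image_law (fun y : outT Y => y j) (W x).
Proof. by apply: funext => y; rewrite /marg /rsum -big_mkcond. Qed.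

Lemma stochastic_marg j : stochastic (marg W j).
Proof.
move=> x; rewrite marg_image_law; have [W0 W1] := HW x; split=> [y|]; first exact: image_law_ge0.
by rewrite -W1 /rsum [RHS](sumR_fiber (fun y : outT Y => y j)).
Qed.

Lemma I_UYE (U : finType) (p : U -> X -> R) j : is_pmf2 p -> I_UY W p j = mix_info (marg W j) p.
Proof. by move=> Hp; rewrite -mutinf_mix_info //; apply: stochastic_marg. Qed.

Lemma I_XYE (q : X -> R) j : is_pmf q -> I_XY W q j = in_info (marg W j) q.
Proof. by move=> Hq; rewrite -mutinf_in_info //; apply: stochastic_marg. Qed.

Lemma I_XY_given_UE (U : finType) (p : U -> X -> R) j : is_pmf2 p ->
  I_XY_given_U W p j = \sum_u in_info (marg W j) (p u).
Proof. by case=> p0 _; rewrite -cmutinf_in_info //; apply: stochastic_marg. Qed.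

Lemma less_noisy_mix_info s c (T : finType) (p : T -> X -> R) :
  less_noisy W s c -> (forall t x, 0 <= p t x) ->
  mix_info (marg W c) p <= mix_info (marg W s) p.
Proof.
move=> ln p0; have HV := stochastic_marg; pose m := \sum_t \sum_x p t x.
have [m0|m0] : 0 <= m by apply: sumR_ge0 => t _; apply: sumR_ge0.
  have i0 := Rlt_le _ _ (Rinv_0_lt_compat _ m0).
  have Hp : is_pmf2 (fun t x => / m * p t x).
    split=> [t x|]; first exact: Rmult_le_pos.
    by rewrite /rsum; under eq_bigr => t _ do rewrite sumR_mull; rewrite sumR_mull Rinv_l; lra.
  have := ln _ _ Hp; rewrite !I_UYE // !mix_infoZ // => /Rmult_le_reg_l; apply.
  exact: Rinv_0_lt_compat.
have p_null t x : p t x = 0.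
  apply: sumR_eq0 (p0 t) _ x; apply: (sumR_eq0 _ (esym m0)) => t'; exact: sumR_ge0.
by rewrite !mix_info0 //; lra.
Qed.

Lemma more_capable_in_info s c (q : X -> R) :
  more_capable W s c -> (forall x, 0 <= q x) -> in_info (marg W c) q <= in_info (marg W s) q.
Proof.
move=> mc q0; have HV := stochastic_marg; pose m := \sum_x q x.
have [m0|m0] : 0 <= m by apply: sumR_ge0.
  have i0 := Rlt_le _ _ (Rinv_0_lt_compat _ m0).
  have Hq : is_pmf (fun x => / m * q x).
    by split=> [x|]; [exact: Rmult_le_pos | rewrite /rsum sumR_mull Rinv_l; lra].
  have := mc _ Hq; rewrite !I_XYE // !in_infoZ // => /Rmult_le_reg_l; apply.
  exact: Rinv_0_lt_compat.
by rewrite !in_info0 //; [lra | |]; apply: sumR_eq0.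
Qed.

Variables (k s : 'I_K).
Hypotheses (rcv_k : rcv k = K) (rcv_s : rcv s = K.-1).

Lemma rcv_eq_last j : (rcv j == K) = (j == k).
Proof.
apply/eqP/eqP=> [jK|-> //]; apply/val_inj/succn_inj; exact: etrans jK (esym rcv_k).
Qed.

Lemma rcv_eq_pred_last j : (rcv j == K.-1) = (j == s).
Proof. by rewrite -rcv_s eqSS. Qed.

Lemma rcv_le_pred_last j : (rcv j <= K.-1)%N = (j != k).
Proof.
by rewrite -rcv_eq_last -ltnS (ltn_predK (ltn_ord j)) ltn_neqAle [(rcv j <= K)%N]ltn_ord andbT.
Qed.

Lemma rcv_le_sub2 j : (rcv j <= K - 2)%N = (j != k) && (j != s).
Proof.
rewrite -rcv_le_pred_last -rcv_eq_pred_last subn2 -ltnS prednK; last by rewrite -rcv_s.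
by rewrite ltn_neqAle andbC.
Qed.

Lemma req1E j : req1 j = (j != k).
Proof. by rewrite /req1 rcv_eq_last. Qed.

Lemma req2E j : req2 j = (j != s).
Proof. by rewrite /req2 rcv_eq_pred_last. Qed.

Lemma classA_more_capable : classA W ->
  (forall j, j != k -> j != s -> more_capable W j s) /\ more_capable W s k.
Proof.
case=> mc_s mc_k; split=> [j jk js|]; last exact: mc_k.
by apply: mc_s => //; rewrite rcv_le_sub2 jk.
Qed.

Lemma classB_less_noisy : classB W -> forall j, j != k -> less_noisy W j k.
Proof. by move=> ln j jk; apply: ln; rewrite ?rcv_le_pred_last. Qed.

Lemma regionE R1 R2 : region W R1 R2 <-> 0 <= R1 /\ 0 <= R2 /\
  exists (U : finType) (p : U -> X -> R),
    is_pmf2 p /\ rate_bounds (marg W) k s p R2 (R2 + R1).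
Proof.
split=> -[R1p [R2p [U [p [Hp bounds]]]]]; split=> //; split=> //; exists U, p; split=> //.
  have [b2 [b12 bs]] := bounds; split=> [|j jk|].
  - by rewrite -I_UYE //; apply: b2.
  - by rewrite -I_XY_given_UE // -I_UYE //; apply: b12; rewrite ?rcv_le_pred_last.
  - by rewrite -I_XYE; [apply: bs | apply: pmf_mixture].
have [b2 b12 bs] := bounds; split=> [i /eqP|]; last split=> [j i jk /eqP|i /eqP].
- by rewrite rcv_eq_last I_UYE // => /eqP ->.
- rewrite rcv_le_pred_last in jk; rewrite rcv_eq_last I_XY_given_UE // I_UYE // => /eqP ->.
  exact: b12.
- by rewrite rcv_eq_pred_last => /eqP ->; rewrite [I_XY _ _ _]I_XYE; last exact: pmf_mixture.
Qed.

End BroadcastChannel.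

(** * Time sharing *)

Section TimeSharing.
Variables (J X T : finType) (Y : J -> finType) (V : forall j, X -> Y j -> R).
Arguments V : clear implicits.
Hypothesis HV : forall j, stochastic (V j).
Variables (n : nat) (p : 'I_n -> T -> X -> R).
Hypotheses (n_gt0 : (0 < n)%N) (Hp : forall i, is_pmf2 (p i)).

Definition time_share (it : 'I_n * T) (x : X) : R := / INR n * p it.1 it.2 x.

Let inv_n_ge0 : 0 <= / INR n.
Proof. exact/Rlt_le/Rinv_0_lt_compat/INR_gt0. Qed.

Let p_ge0 i t x : 0 <= p i t x.
Proof. by case: (Hp i). Qed.

Lemma sumR_time_share (F : (X -> R) -> R) :
  (forall q, (forall x, 0 <= q x) -> F (fun x => / INR n * q x) = / INR n * F q) ->
  \sum_it F (time_share it) = / INR n * \sum_(i < n) \sum_t F (p i t).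
Proof.
move=> FZ; rewrite sumR_pair -sumR_mull; apply: eq_bigr => i _.
by rewrite -sumR_mull; apply: eq_bigr => t _; rewrite FZ //; apply: p_ge0.
Qed.

Lemma mixture_time_share x :
  mixture time_share x = mixture (fun i x => / INR n * mixture (p i) x) x.
Proof. by rewrite /mixture sumR_pair; apply: eq_bigr => i _; rewrite sumR_mull. Qed.

Lemma pmf2_time_share : is_pmf2 time_share.
Proof.
split=> [it x|]; first by apply: Rmult_le_pos; [exact: inv_n_ge0 | exact: p_ge0].
rewrite /rsum (@sumR_time_share (fun q => \sum_x q x)) => [|q _]; last exact: sumR_mull.
rewrite (eq_bigr (fun=> 1)) => [|i _]; last by case: (Hp i).
by rewrite sumR_const card_ord; field; have := INR_gt0 n_gt0; lra.
Qed.

Lemma out_entropy_time_share j :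
  / INR n * \sum_(i < n) out_entropy (V j) (mixture (p i)) <=
  out_entropy (V j) (mixture time_share).
Proof.
have inv0 := inv_n_ge0; have mix0 i := mixture_ge0 (p_ge0 i).
rewrite (eq_out_entropy (V j) mixture_time_share) -sumR_mull.
under eq_bigr => i _ do rewrite -(out_entropyZ (HV j) inv0 (mix0 i)).
by apply: sum_out_entropy_le_mixture => // i x; apply: Rmult_le_pos.
Qed.

Lemma mix_info_time_share j :
  / INR n * \sum_(i < n) mix_info (V j) (p i) <= mix_info (V j) time_share.
Proof.
rewrite /mix_info (sumR_time_share (fun q => @out_entropyZ _ _ _ (HV j) _ q inv_n_ge0)).
by rewrite sumRB Rmult_minus_distr_l; apply/Rplus_le_compat_r/out_entropy_time_share.
Qed.

Lemma in_info_time_share j :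
  / INR n * \sum_(i < n) in_info (V j) (mixture (p i)) <= in_info (V j) (mixture time_share).
Proof.
rewrite -mix_info_in_info (sumR_time_share (fun q => @in_infoZ _ _ _ (HV j) _ q inv_n_ge0)).
under eq_bigr => i _ do rewrite -mix_info_in_info.
by rewrite big_split Rmult_plus_distr_l; apply/Rplus_le_compat_r/mix_info_time_share.
Qed.

Lemma rate_bounds_time_share k s r2 r12 :
  r2 <= \sum_(i < n) mix_info (V k) (p i) ->
  (forall j, j != k ->
     r12 <= \sum_(i < n) \sum_t in_info (V j) (p i t) + \sum_(i < n) mix_info (V k) (p i)) ->
  r12 <= \sum_(i < n) in_info (V s) (mixture (p i)) ->
  rate_bounds V k s time_share (/ INR n * r2) (/ INR n * r12).
Proof.
have scale r r' : r <= r' -> / INR n * r <= / INR n * r'.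
  by apply: Rmult_le_compat_l; exact: inv_n_ge0.
move=> /scale b2 b12 /scale bs; split=> [|j jk|].
- exact: Rle_trans b2 (mix_info_time_share k).
- have := scale _ _ (b12 j jk).
  rewrite (sumR_time_share (fun q => @in_infoZ _ _ _ (HV j) _ q inv_n_ge0)).
  by have := mix_info_time_share k; lra.
- exact: Rle_trans bs (in_info_time_share s).
Qed.

End TimeSharing.

(** * Entropy of finite random variables *)

Definition entropy (Om T : finType) (P : Om -> R) (f : Om -> T) : R :=
  - \sum_t xlog (image_law f P t).

Section Entropy.
Variables (Om : finType) (P : Om -> R).

Lemma image_lawE (T : finType) (f : Om -> T) t : image_law f P t = \Pr_(w <- P) (f w == t).
Proof.
rewrite /image_law big_mkcond; apply: eq_bigr => w _.
by case: eqP => _; rewrite /indic; ring.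
Qed.

Lemma sum_image_law_pair (T U : finType) (f : Om -> T) (g : Om -> U) t :
  \sum_u image_law (fun w => (f w, g w)) P (t, u) = image_law f P t.
Proof. by rewrite [RHS](partition_big g xpredT). Qed.

Lemma sum_image_law_pair_fst (T U : finType) (f : Om -> T) (g : Om -> U) u :
  \sum_t image_law (fun w => (f w, g w)) P (t, u) = image_law g P u.
Proof.
rewrite [RHS](partition_big f xpredT) //; apply: eq_bigr => t _.
by apply: eq_bigl => w; rewrite xpair_eqE andbC.
Qed.

Lemma entropyE (T : finType) (f : Om -> T) :
  entropy P f = - \E_(w <- P) log2 (image_law f P (f w)).
Proof. by rewrite -(expect_image P f (fun t => log2 (image_law f P t))). Qed.

Lemma eq_entropy_kernel (T T' : finType) (f : Om -> T) (g : Om -> T') :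
  (forall w w', (f w == f w') = (g w == g w')) -> entropy P f = entropy P g.
Proof.
move=> fg; rewrite !entropyE; congr (- _); apply: eq_expect => w; congr log2.
by apply: eq_bigl => w'; apply: fg.
Qed.

Lemma entropy_const (T : finType) (t : T) : is_pmf P -> entropy P (fun=> t) = 0.
Proof.
case=> _ P1; rewrite entropyE (eq_expect _ (g := fun=> 0)) ?/expect ?sumR_mulr; first lra.
by move=> w; rewrite /image_law (eq_bigl xpredT) => [|w']; rewrite ?eqxx // [\sum_w _]P1 log2_1.
Qed.

End Entropy.

Lemma pmf_image (A B : finType) (f : A -> B) (P : A -> R) : is_pmf P -> is_pmf (image_law f P).
Proof.
case=> P0 P1; split=> [b|]; first exact: image_law_ge0.
by rewrite -P1 /rsum [RHS](sumR_fiber f).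
Qed.

Lemma entropy_joint_fst (A B T : finType) (P : A -> R) (V : A -> B -> R) (f : A -> T) :
  stochastic V -> entropy (joint_law P V) (fun w => f w.1) = entropy P f.
Proof.
move=> HV; congr (- _); apply: eq_bigr => t _; congr xlog; rewrite !image_lawE expect_joint.
by apply: eq_expect => a; rewrite /= expect_const.
Qed.

Definition uniform (M : finType) (m : M) : R := / INR #|M|.

Lemma pmf_uniform (M : finType) : (0 < #|M|)%N -> is_pmf (@uniform M).
Proof.
move=> /INR_gt0 M0; split=> [m|]; first exact/Rlt_le/Rinv_0_lt_compat.
by rewrite /rsum sumR_const Rinv_r; lra.
Qed.

Lemma image_law_uniform_snd (M1 M2 : finType) m2 : (0 < #|M1|)%N ->
  image_law (@snd M1 M2) (@uniform _) m2 = uniform m2.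
Proof.
move=> /INR_gt0 M1_gt0; rewrite image_lawE /expect sumR_pair /=.
have -> : \sum_(m1 : M1) \sum_m2' uniform (m1, m2') * indic (m2' == m2) =
    \sum_(m1 : M1) / (INR #|M1| * INR #|M2|).
  apply: eq_bigr => m1 _; rewrite (bigD1 m2) //= eqxx big1 => [|m2' /negbTE ->].
    by rewrite /uniform card_prod mult_INR /indic /=; ring.
  by rewrite /indic; ring.
by rewrite sumR_const Rinv_mult /uniform -Rmult_assoc Rinv_r; lra.
Qed.

Definition log_card (M : finType) : R := log2 (INR #|M|).

Lemma entropy_uniform (Om M : finType) (P : Om -> R) (f : Om -> M) : (0 < #|M|)%N ->
  (forall m, image_law f P m = uniform m) -> entropy P f = log_card M.
Proof.
move=> /INR_gt0 M0 fU; rewrite /entropy; under eq_bigr => m _ do rewrite fU /uniform.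
by rewrite sumR_const /xlog /log_card log2_inv //; field; lra.
Qed.

Lemma log_card_ge0 (M : finType) : (0 < #|M|)%N -> 0 <= log_card M.
Proof.
move=> M_gt0; rewrite -log2_1; apply: log2_le; first lra.
by rewrite -INR_1; apply/le_INR/leP.
Qed.

(** * Fano's inequality *)

(* With half of the mass on the estimate [m0], the cross entropy is Fano's bound. *)
Definition guess_law (M : finType) (m0 m : M) : R :=
  if m0 == m then / 2 else / (2 * INR #|M|).

Section GuessLaw.
Variables (M : finType) (m0 : M).

Let card_ge1 : 1 <= INR #|M|.
Proof. by rewrite -INR_1; apply: le_INR; apply/leP/card_gt0P; exists m0. Qed.

Lemma guess_law_gt0 m : 0 < guess_law m0 m.
Proof. by rewrite /guess_law /log_card; case: eqP => _; apply: Rinv_0_lt_compat; lra. Qed.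

Lemma guess_law_mass_le1 : \sum_m guess_law m0 m <= 1.
Proof.
rewrite (bigD1 m0) //= {1}/guess_law eqxx.
rewrite (eq_bigr (fun=> / (2 * INR #|M|))) => [|m]; last first.
  by rewrite eq_sym /guess_law => /negbTE ->.
rewrite sumR_const_neq; apply: (@Rle_trans _ (/ 2 + INR #|M| * / (2 * INR #|M|))).
  apply: Rplus_le_compat_l; apply: Rmult_le_compat_r; last exact/le_INR/leP/leq_pred.
  by apply/Rlt_le/Rinv_0_lt_compat; lra.
by apply: Req_le; field; lra.
Qed.

Lemma log2_guess_law m :
  - log2 (guess_law m0 m) = 1 + indic (m0 != m) * log_card M.
Proof.
rewrite /guess_law /log_card.
by case: eqP => _; rewrite [indic _]/= log2_inv ?log2_mult ?log2_2; lra.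
Qed.

End GuessLaw.

Lemma cond_entropy_le_cross_entropy (Om M T : finType) (P : Om -> R) (f : Om -> M) (V : Om -> T)
    (Q : T -> M -> R) :
  is_pmf P -> (forall v m, 0 < Q v m) -> (forall v, \sum_m Q v m <= 1) ->
  entropy P (fun w => (f w, V w)) - entropy P V <= \E_(w <- P) - log2 (Q (V w) (f w)).
Proof.
move=> HP Q0 Q1; have P0 := pmf_ge0 HP.
pose joint := image_law (fun w => (f w, V w)) P.
pose cross (mv : M * T) := Q mv.2 mv.1 * image_law V P mv.2.
have V0 v : 0 <= image_law V P v by apply: image_law_ge0.
have joint0 mv : 0 <= joint mv by apply: image_law_ge0.
have joint_le m v : joint (m, v) <= image_law V P v.
  by rewrite -(sum_image_law_pair_fst P f V v); apply: (leR_sum_term m (fun m => joint0 (m, v))).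
have div_ge0 : 0 <= divergence joint cross.
  apply: divergence_ge0 => [//|mv|[m v]|].
  - by apply: Rmult_le_pos => //; apply: Rlt_le.
  - case/Rmult_integral => [|/= Vv]; first by have := Q0 v m; rewrite /=; lra.
    by have := joint_le m v; have := joint0 (m, v); lra.
  rewrite (pmf_sum1 (pmf_image _ HP)) sumR_pair exchange_big -(pmf_sum1 (pmf_image V HP)).
  apply: leR_sum => v _; rewrite /cross /= sumR_mulr -[X in _ <= X]Rmult_1_l.
  exact: Rmult_le_compat_r.
have divE : divergence joint cross = \E_(w <- P) (log2 (joint (f w, V w)) +
    (- log2 (image_law V P (V w)) + - log2 (Q (V w) (f w)))).
  transitivity (\E_(w <- P) log2 (joint (f w, V w) / cross (f w, V w))).
    rewrite -(expect_image P (fun w => (f w, V w)) (fun mv => log2 (joint mv / cross mv))).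
    by apply: eq_bigr => mv _; rewrite plogqE.
  apply: eq_expect_pos => // w Pw.
  have joint_pos : 0 < joint (f w, V w).
    by apply: Rlt_le_trans Pw _; apply: (@leR_sum_term_cond _ _ P w).
  have V_pos : 0 < image_law V P (V w) by apply: Rlt_le_trans joint_pos (joint_le _ _).
  by rewrite log2_div ?log2_mult //=; [ring | apply: Rmult_lt_0_compat].
rewrite divE !expectD expectN -[\E_(w <- P) log2 (joint _)]Ropp_involutive -!entropyE in div_ge0.
lra.
Qed.

Lemma fano (Om M T : finType) (P : Om -> R) (f : Om -> M) (V : Om -> T) (g : T -> M) :
  is_pmf P ->
  entropy P (fun w => (f w, V w)) - entropy P V <=
  1 + (\Pr_(w <- P) (g (V w) != f w)) * log_card M.
Proof.
move=> HP; rewrite -(expect_const 1 HP) -expectMr -expectD.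
under [X in _ <= X]eq_expect => w do rewrite -log2_guess_law.
apply: (cond_entropy_le_cross_entropy f V (Q := fun v => guess_law (g v)) HP) => v.
  exact: guess_law_gt0.
exact: guess_law_mass_le1.
Qed.

(** * Conditional output entropies of a code *)

Section Transmission.
Variables (K : nat) (X : finType) (Y : 'I_K -> finType) (W : X -> outT Y -> R).
Hypothesis HW : is_channel W.
Variables (n : nat) (M : finType) (enc : M -> {ffun 'I_n -> X}).
Hypothesis M_gt0 : (0 < #|M|)%N.

Local Notation Om := (M * {ffun 'I_n -> outT Y})%type.

Definition code_law : Om -> R := joint_law (@uniform M) (fun m => memoryless W (enc m)).

Lemma pmf_code_law : is_pmf code_law.
Proof. by apply: pmf_joint; [apply: pmf_uniform | move=> m; apply: stochastic_memoryless]. Qed.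

Lemma entropy_message (T : finType) (A : M -> T) :
  entropy code_law (fun w => A w.1) = entropy (@uniform M) A.
Proof. by apply: entropy_joint_fst => m; apply: stochastic_memoryless. Qed.

Definition letter (i : 'I_n) (w : Om) : X := enc w.1 i.

Definition letter_law (i : 'I_n) : X -> R := image_law (letter i) code_law.

Definition input_law (T : finType) (V : Om -> T) (i : 'I_n) (v : T) (x : X) : R :=
  image_law (fun w => (V w, letter i w)) code_law (v, x).

(* [H (Y_j,i | V)] whenever [V] [ignores] time [i]. *)
Definition cond_out_entropy (j : 'I_K) (T : finType) (V : Om -> T) (i : 'I_n) : R :=
  \sum_v out_entropy (marg W j) (input_law V i v).

Local Notation H := (entropy code_law).
Local Notation noise j i := (\E_(x <- letter_law i) noise_entropy (marg W j) x).

Section InputLaw.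
Variables (T : finType) (V : Om -> T) (i : 'I_n).

Lemma input_law_ge0 v x : 0 <= input_law V i v x.
Proof. exact/image_law_ge0/pmf_ge0/pmf_code_law. Qed.

Lemma mixture_input_law : mixture (input_law V i) = letter_law i.
Proof. by apply: funext => x; apply: sum_image_law_pair_fst. Qed.

Lemma input_law_mass v : \sum_x input_law V i v x = image_law V code_law v.
Proof. exact: sum_image_law_pair. Qed.

Lemma pmf_letter_law : is_pmf (letter_law i).
Proof. exact/pmf_image/pmf_code_law. Qed.

Lemma pmf2_input_law : is_pmf2 (input_law V i).
Proof.
split; first exact: input_law_ge0.
by rewrite /rsum -mixture_mass mixture_input_law (pmf_sum1 pmf_letter_law).
Qed.

Lemma mix_info_input_law j :
  mix_info (marg W j) (input_law V i) =
  out_entropy (marg W j) (letter_law i) - cond_out_entropy j V i.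
Proof. by rewrite /mix_info mixture_input_law. Qed.

Lemma in_info_input_law j :
  \sum_v in_info (marg W j) (input_law V i v) = cond_out_entropy j V i - noise j i.
Proof. by rewrite sumRB -expect_mixture mixture_input_law. Qed.

Lemma cond_out_entropy_determined j (phi : T -> X) :
  (forall w, letter i w = phi (V w)) -> cond_out_entropy j V i = noise j i.
Proof.
move=> phiV; rewrite -mixture_input_law expect_mixture; apply: eq_bigr => v _.
apply: (out_entropy_point (stochastic_marg HW j) (x := phi v)); first exact: input_law_ge0.
move=> x /negbTE x_phi; apply: big_pred0 => w; rewrite xpair_eqE phiV.
by case: eqP => //= ->; rewrite eq_sym.
Qed.

Definition ignores : Prop := forall m y z, V (m, upd y i z) = V (m, y).

Lemma expect_code_law_resample (F : Om -> outT Y -> R) :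
  (forall m y z b, F (m, upd y i z) b = F (m, y) b) ->
  \E_(w <- code_law) F w (w.2 i) = \E_(w <- code_law) \E_(b <- W (letter i w)) F w b.
Proof.
move=> Fi; rewrite !expect_joint; apply: eq_expect => m.
by apply: (@expect_resample _ _ (fun t => W (enc m t)) _ i (fun y b => F (m, y) b)).
Qed.

Lemma image_law_output j v (y : Y j) : ignores ->
  image_law (fun w : Om => (V w, w.2 i j)) code_law (v, y) =
  output (input_law V i v) (marg W j) y.
Proof.
move=> Vi; pose F (w : Om) (b : outT Y) := indic (V w == v) * indic (b j == y).
rewrite image_lawE; transitivity (\E_(w <- code_law) F w (w.2 i)).
  apply: eq_expect => w; rewrite xpair_eqE /F.
  by case: (V w == v); case: (_ == y); rewrite /indic /=; ring.
rewrite expect_code_law_resample => [|m f z b]; last by rewrite /F Vi.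
transitivity (\E_(w <- code_law) (indic (V w == v) * marg W j (letter i w) y)).
  by apply: eq_expect => w; rewrite expectMl marg_image_law image_lawE.
rewrite -(expect_image code_law (fun w => (V w, letter i w))
  (fun vx => indic (vx.1 == v) * marg W j vx.2 y)) /expect sumR_pair (bigD1 v) //=.
rewrite [X in _ + X]big1 ?Rplus_0_r => [|v' /negbTE ->]; last first.
  by apply: big1 => x _; rewrite /indic; ring.
by rewrite eqxx; apply: eq_bigr => x _; rewrite /indic Rmult_1_l.
Qed.

Lemma entropy_output j : ignores -> H (fun w : Om => (V w, w.2 i j)) = H V + cond_out_entropy j V i.
Proof.
move=> Vi; rewrite /cond_out_entropy /out_entropy sumRB /entropy sumR_pair.
under eq_bigr => v _ do under eq_bigr => y _ do rewrite image_law_output //.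
by under [X in _ + (X - _)]eq_bigr => v _ do rewrite input_law_mass; ring.
Qed.

End InputLaw.

Section Refinement.
Variables (T T' : finType) (V : Om -> T) (V' : Om -> T') (phi : T' -> T) (i : 'I_n).
Hypothesis Vphi : forall w, V w = phi (V' w).

Local Notation joint_input v v' := (input_law (fun w => (V w, V' w)) i (v, v')).

Lemma joint_inputE v v' x : joint_input v v' x = if phi v' == v then input_law V' i v' x else 0.
Proof.
case: eqP => [<-|phi_v]; last first.
  by apply: big_pred0 => w; rewrite !xpair_eqE Vphi; case: (V' w =P v') => [-> |]; case: eqP.
by apply: eq_bigl => w; rewrite !xpair_eqE Vphi; case: (V' w =P v') => [->|]; rewrite ?eqxx ?andbF.
Qed.

Lemma cond_out_entropy_refine j :
  cond_out_entropy j V i - cond_out_entropy j V' i =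
  \sum_v mix_info (marg W j) (fun v' => joint_input v v').
Proof.
rewrite sumRB; congr (_ - _).
  apply: eq_bigr => v _; apply: eq_out_entropy => x; rewrite /mixture.
  rewrite [LHS](partition_big V' xpredT) //; apply: eq_bigr => v' _; apply: eq_bigl => w.
  by rewrite !xpair_eqE andbAC.
rewrite exchange_big; apply: eq_bigr => v' _; rewrite (bigD1 (phi v')) //= big1 => [|v vphi].
  by rewrite Rplus_0_r; apply: eq_out_entropy => x; rewrite (joint_inputE _ v') eqxx.
apply: (out_entropy0 (stochastic_marg HW j)) => x.
by rewrite (joint_inputE v) eq_sym (negbTE vphi).
Qed.

Lemma cond_out_entropy_coarsen j : cond_out_entropy j V' i <= cond_out_entropy j V i.
Proof.
have : 0 <= cond_out_entropy j V i - cond_out_entropy j V' i; last lra.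
rewrite cond_out_entropy_refine; apply: sumR_ge0 => v _.
by apply: mix_info_ge0 => [|v' x]; [apply: stochastic_marg | apply: input_law_ge0].
Qed.

Lemma cond_out_entropy_less_noisy s c : less_noisy W s c ->
  cond_out_entropy c V i - cond_out_entropy c V' i <=
  cond_out_entropy s V i - cond_out_entropy s V' i.
Proof.
move=> ln; rewrite !cond_out_entropy_refine; apply: leR_sum => v _.
by apply: less_noisy_mix_info => // v' x; apply: input_law_ge0.
Qed.

End Refinement.

(** * Partial observations *)

Local Notation pattern := {ffun 'I_n -> option 'I_K}.

Definition observe (s : pattern) (w : Om) : {ffun 'I_n -> option {j : 'I_K & Y j}} :=
  [ffun t => omap (fun j => Tagged (fun j => Y j) (w.2 t j)) (s t)].

Definition view (T : finType) (A : M -> T) (s : pattern) (w : Om) := (A w.1, observe s w).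

Definition silent : pattern := [ffun=> None].
Definition full (j : 'I_K) : pattern := [ffun=> Some j].
Definition past (j : 'I_K) (r : nat) : pattern :=
  [ffun t : 'I_n => if (t < r)%N then Some j else None].
Definition hybrid (k s : 'I_K) (r : nat) : pattern :=
  [ffun t : 'I_n => if (t < r)%N then Some k else if t == r :> nat then None else Some s].

Definition subpattern (s s' : pattern) : Prop := forall t, s t = None \/ s t = s' t.

Definition restrict_view (T : finType) (s : pattern)
    (v : T * {ffun 'I_n -> option {j : 'I_K & Y j}}) :=
  (v.1, [ffun t => if s t is None then None else v.2 t]).

Section Views.
Variables (T : finType) (A : M -> T).
Implicit Types (s : pattern) (j c : 'I_K) (i : 'I_n).

Lemma view_restrict s s' w : subpattern s s' -> view A s w = restrict_view s (view A s' w).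
Proof.
move=> ss'; congr pair; apply/ffunP => t; rewrite !ffunE.
by case: (ss' t) => st; rewrite st //; case: (s' t).
Qed.

Lemma view_ignores s i : s i = None -> ignores (view A s) i.
Proof.
move=> si m y z; congr pair; apply/ffunP => t; rewrite !ffunE.
by case: (eqVneq t i) => [->|ti]; rewrite ?si //; case: (s t) => //= j; rewrite upd_neq.
Qed.

Lemma view_upd_eq s i j w w' : s i = None ->
  (view A (upd s i (Some j)) w == view A (upd s i (Some j)) w') =
  ((view A s w, w.2 i j) == (view A s w', w'.2 i j)).
Proof.
move=> si; rewrite !xpair_eqE -andbA; congr (_ && _).
apply/eqP/andP => [obs|[/eqP obs /eqP out_i]].
  split; apply/eqP.
    apply/ffunP => t; move/ffunP/(_ t): obs; rewrite !ffunE.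
    by case: (eqVneq t i) => [->|//]; rewrite si.
  move/ffunP/(_ i): obs; rewrite !ffunE eqxx /= => -[/eqP].
  by rewrite eq_Tagged => /eqP.
apply/ffunP => t; rewrite !ffunE; case: (eqVneq t i) => [->|ti] /=; first by rewrite out_i.
by move/ffunP/(_ t): obs; rewrite !ffunE.
Qed.

Lemma entropy_view_upd s i j : s i = None ->
  H (view A (upd s i (Some j))) = H (view A s) + cond_out_entropy j (view A s) i.
Proof.
move=> si; rewrite -entropy_output; last exact: view_ignores.
by apply: eq_entropy_kernel => w w'; apply: view_upd_eq.
Qed.

Lemma entropy_view_silent : H (view A silent) = H (fun w => A w.1).
Proof.
apply: eq_entropy_kernel => w w'; rewrite xpair_eqE.
suff -> : observe silent w = observe silent w' by rewrite eqxx andbT.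
by apply/ffunP => t; rewrite !ffunE.
Qed.

Lemma chain_rule j :
  H (view A (full j)) - H (fun w => A w.1) = \sum_(i < n) cond_out_entropy j (view A (past j i)) i.
Proof.
have -> : full j = past j n by apply/ffunP => t; rewrite !ffunE ltn_ord.
rewrite -entropy_view_silent; have -> : silent = past j 0 by apply/ffunP => t; rewrite !ffunE.
rewrite -(telescope_sumR_ord (fun r => H (view A (past j r)))); apply: eq_bigr => i _.
have -> : past j i.+1 = upd (past j i) i (Some j).
  by apply/ffunP => t; rewrite !ffunE ltnS leq_eqVlt -val_eqE /=; case: eqP.
by rewrite entropy_view_upd ?ffunE ?ltnn //; ring.
Qed.

(* Csiszár's sum identity: the outputs of [s] are replaced by those of [k] one at a time. *)
Lemma csiszar_sum (k s : 'I_K) :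
  H (view A (full k)) - H (view A (full s)) =
  \sum_(i < n) cond_out_entropy k (view A (hybrid k s i)) i
  - \sum_(i < n) cond_out_entropy s (view A (hybrid k s i)) i.
Proof.
rewrite -sumRB.
pose switch r : pattern := [ffun t : 'I_n => if (t < r)%N then Some k else Some s].
have -> : full k = switch n by apply/ffunP => t; rewrite !ffunE ltn_ord.
have -> : full s = switch 0%N by apply/ffunP => t; rewrite !ffunE.
rewrite -(telescope_sumR_ord (fun r => H (view A (switch r)))); apply: eq_bigr => i _.
have -> : switch i.+1 = upd (hybrid k s i) i (Some k).
  by apply/ffunP => t; rewrite !ffunE ltnS leq_eqVlt -val_eqE /=; case: eqP.
have -> : switch i = upd (hybrid k s i) i (Some s).
  by apply/ffunP => t; rewrite !ffunE -val_eqE /=; case: eqP => [->|]; rewrite ?ltnn.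
by rewrite !entropy_view_upd ?ffunE ?ltnn ?eqxx //; ring.
Qed.

Lemma cond_out_entropy_subpattern j s s' i : subpattern s s' ->
  cond_out_entropy j (view A s') i <= cond_out_entropy j (view A s) i.
Proof.
move=> ss'; apply: (cond_out_entropy_coarsen (phi := @restrict_view T s)) => w.
exact: view_restrict.
Qed.

(* Writing both sides as differences of entropies, the claim becomes the statement that at time
   [r] the receiver [j] learns more than [c] from the [i]-th output of [j]. *)
Lemma cond_out_entropy_exchange j c s i (r : 'I_n) :
  less_noisy W j c -> s i = None -> s r = None -> r != i ->
  cond_out_entropy j (view A (upd s r (Some j))) i <=
  cond_out_entropy j (view A (upd s r (Some c))) i.
Proof.
move=> ln si sr ri; have ir : i != r by rewrite eq_sym.
pose s' : pattern := upd s i (Some j); have s'r : s' r = None by rewrite upd_neq.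
have chain (a : 'I_K) : cond_out_entropy j (view A (upd s r (Some a))) i =
    H (view A s') + cond_out_entropy a (view A s') r
    - (H (view A s) + cond_out_entropy a (view A s) r).
  rewrite -(entropy_view_upd _ s'r) -(entropy_view_upd _ sr) /s' upd_swap //.
  by rewrite [X in _ = X - _]entropy_view_upd ?upd_neq //; ring.
have ss' : subpattern s s'.
  by move=> t; rewrite !ffunE; case: (eqVneq t i) => [->|_]; [left | right].
have := cond_out_entropy_less_noisy r (fun w => view_restrict w ss') ln.
by rewrite !chain; lra.
Qed.

Lemma cond_out_entropy_past_less_noisy j c (i : 'I_n) : less_noisy W j c ->
  cond_out_entropy j (view A (past j i)) i <= cond_out_entropy j (view A (past c i)) i.
Proof.
move=> ln; pose mixed m : pattern :=
  [ffun t : 'I_n => if (t < m)%N then Some j else if (t < i)%N then Some c else None].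
have -> : past j i = mixed i by apply/ffunP => t; rewrite !ffunE; case: ifP.
have -> : past c i = mixed 0%N by apply/ffunP => t; rewrite !ffunE.
suff mono m : (m <= i)%N ->
    cond_out_entropy j (view A (mixed m)) i <= cond_out_entropy j (view A (mixed 0%N)) i.
  exact: mono.
elim: m => [|m IH] mi; first exact: Rle_refl.
apply: Rle_trans (IH (ltnW mi)); pose r := Ordinal (ltn_trans mi (ltn_ord i)).
pose rest := upd (mixed m) r None.
have -> : mixed m.+1 = upd rest r (Some j).
  by apply/ffunP => t; rewrite !ffunE ltnS leq_eqVlt -val_eqE /=; case: eqP.
have -> : mixed m = upd rest r (Some c).
  by apply/ffunP => t; rewrite !ffunE -val_eqE /=; case: eqP => [->|]; rewrite ?ltnn ?mi.
have ri : r != i by rewrite -val_eqE /= neq_ltn mi.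
apply: cond_out_entropy_exchange => //; rewrite !ffunE ?eqxx // eq_sym (negbTE ri).
by rewrite ltnn ltnNge ltnW.
Qed.

End Views.
End Transmission.

Arguments full {K n} j.
Arguments past {K n} j r.
Arguments hybrid {K n} k s r.

(** * Converse *)

Section FanoForCodes.
Variables (K : nat) (X : finType) (Y : 'I_K -> finType) (W : X -> outT Y -> R).
Hypothesis HW : is_channel W.
Variables (n : nat) (M : finType) (enc : M -> {ffun 'I_n -> X}).
Hypothesis M_gt0 : (0 < #|M|)%N.

Local Notation law := (code_law W enc).
Local Notation H := (entropy law).

Definition decodes (e : R) (j : 'I_K) (T : finType) (A : M -> T) : Prop :=
  exists g : {ffun 'I_n -> Y j} -> T,
    \Pr_(w <- law) (g [ffun t => w.2 t j] != A w.1) <= e.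

Definition sum_out_entropy (j : 'I_K) : R :=
  \sum_(i < n) out_entropy (marg W j) (letter_law W enc i).

Definition sum_noise_entropy (j : 'I_K) : R :=
  \sum_(i < n) \E_(x <- letter_law W enc i) noise_entropy (marg W j) x.

Lemma sum_mix_info_input_law (T : finType) (V : 'I_n -> M * {ffun 'I_n -> outT Y} -> T) j :
  \sum_(i < n) mix_info (marg W j) (input_law W enc (V i) i) =
  sum_out_entropy j - \sum_(i < n) cond_out_entropy W enc j (V i) i.
Proof. by rewrite -sumRB; apply: eq_bigr => i _; rewrite mix_info_input_law. Qed.

Lemma sum_in_info_input_law (T : finType) (V : 'I_n -> M * {ffun 'I_n -> outT Y} -> T) j :
  \sum_(i < n) \sum_v in_info (marg W j) (input_law W enc (V i) i v) =
  \sum_(i < n) cond_out_entropy W enc j (V i) i - sum_noise_entropy j.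
Proof. by rewrite -sumRB; apply: eq_bigr => i _; rewrite in_info_input_law. Qed.

Lemma sum_in_info_letter_law (T : finType) (V : 'I_n -> M * {ffun 'I_n -> outT Y} -> T) j :
  \sum_(i < n) in_info (marg W j) (mixture (input_law W enc (V i) i)) =
  sum_out_entropy j - sum_noise_entropy j.
Proof. by rewrite -sumRB; apply: eq_bigr => i _; rewrite mixture_input_law. Qed.

Lemma entropy_full_le j : H (view (fun=> tt) (full j)) <= sum_out_entropy j.
Proof.
have := chain_rule HW enc (fun=> tt) j.
rewrite (entropy_const tt (pmf_code_law HW enc M_gt0)) Rminus_0_r => ->.
apply: leR_sum => i _; have := mix_info_ge0 (stochastic_marg HW j)
  (input_law_ge0 HW enc M_gt0 (view (fun=> tt) (past j i)) i).
by rewrite mix_info_input_law //; lra.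
Qed.

Lemma entropy_message_full j :
  H (view id (full j)) = log_card M + sum_noise_entropy j.
Proof.
have message : H (fun w => id w.1) = log_card M.
  by rewrite (entropy_message HW enc id); apply: entropy_uniform => // m; apply: big_pred1_eq.
have := chain_rule HW enc id j; rewrite message.
have -> : \sum_(i < n) cond_out_entropy W enc j (view id (past j i)) i = sum_noise_entropy j.
  apply: eq_bigr => i _.
  by apply: (cond_out_entropy_determined HW M_gt0 _ (phi := fun v => enc v.1 i)).
by move=> chain; lra.
Qed.

Lemma observe_full_eq j (w w' : M * {ffun 'I_n -> outT Y}) :
  (observe (full j) w == observe (full j) w') =
  ([ffun t => w.2 t j] == [ffun t => w'.2 t j]).
Proof.
apply/eqP/eqP => /ffunP obs; apply/ffunP => t; have := obs t; rewrite !ffunE /=.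
  by case=> /eqP; rewrite eq_Tagged => /eqP.
by move=> ->.
Qed.

Lemma fano_view e j (T T' : finType) (A : M -> T) (B : M -> T') : decodes e j A ->
  H (fun w => (A w.1, view B (full j) w)) - H (view B (full j)) <=
  1 + e * log_card T.
Proof.
move=> [g err]; pose V (w : M * {ffun 'I_n -> outT Y}) := (B w.1, [ffun t => w.2 t j]).
have view_eq w w' : (view B (full j) w == view B (full j) w') = (V w == V w').
  by rewrite !xpair_eqE observe_full_eq.
rewrite (@eq_entropy_kernel _ law _ _ _ V view_eq).
rewrite (@eq_entropy_kernel _ law _ _ _ (fun w => (A w.1, V w))); last first.
  by move=> w w'; rewrite !(xpair_eqE (A _)) view_eq.
apply: Rle_trans (fano _ V (fun v => g v.2) (pmf_code_law HW enc M_gt0)) _.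
apply/Rplus_le_compat_l/Rmult_le_compat_r => //; have [m _] := card_gt0P M_gt0.
by apply/log_card_ge0/card_gt0P; exists (A m).
Qed.

Lemma entropy_view_full_le e j (T : finType) (B : M -> T) : decodes e j B ->
  H (view B (full j)) <= sum_out_entropy j + 1 + e * log_card T.
Proof.
move=> /fano_view - /(_ _ (fun=> tt)); have := entropy_full_le j.
have -> : H (fun w => (B w.1, view (fun=> tt) (full j) w)) = H (view B (full j)).
  by apply: eq_entropy_kernel => w w'; rewrite !xpair_eqE.
by lra.
Qed.

Lemma message_entropy_le e j (T T' : finType) (A : M -> T) (B : M -> T') :
  injective (fun m => (A m, B m)) -> decodes e j A ->
  log_card M + sum_noise_entropy j - H (view B (full j)) <= 1 + e * log_card T.
Proof.
move=> AB_inj /fano_view - /(_ _ B); rewrite -entropy_message_full.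
have -> : H (fun w => (A w.1, view B (full j) w)) = H (view id (full j)); last by [].
apply: eq_entropy_kernel => w w'; rewrite !xpair_eqE andbA; congr (_ && _).
by rewrite -(inj_eq AB_inj) xpair_eqE.
Qed.

Lemma sum_rate_le e j k (T T' : finType) (A : M -> T) (B : M -> T') :
  injective (fun m => (A m, B m)) -> decodes e j A -> decodes e k B ->
  log_card M - e * (log_card T + log_card T') - 2 <=
  H (view B (full j)) - sum_noise_entropy j + (sum_out_entropy k - H (view B (full k))).
Proof.
move=> AB_inj /(message_entropy_le AB_inj) A_le /entropy_view_full_le B_le; lra.
Qed.

Lemma full_view_more_capable k s (T : finType) (B : M -> T) : more_capable W s k ->
  H (view B (full k)) - sum_noise_entropy k <= H (view B (full s)) - sum_noise_entropy s.
Proof.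
move=> mc; have := csiszar_sum HW enc B k s.
have : \sum_(i < n) \sum_v in_info (marg W k) (input_law W enc (view B (hybrid k s i)) i v) <=
       \sum_(i < n) \sum_v in_info (marg W s) (input_law W enc (view B (hybrid k s i)) i v).
  apply: leR_sum => i _; apply: leR_sum => v _; apply: more_capable_in_info => //.
  by move=> x; apply: input_law_ge0.
by rewrite !(sum_in_info_input_law (fun i => view B (hybrid k s i))); lra.
Qed.

End FanoForCodes.

Section Converse.
Variables (K : nat) (X : finType) (Y : 'I_K -> finType) (W : X -> outT Y -> R).
Hypothesis HW : is_channel W.
Variables (n : nat) (M1 M2 : finType) (enc : M1 * M2 -> {ffun 'I_n -> X}).
Hypotheses (n_gt0 : (0 < n)%N) (M1_gt0 : (0 < #|M1|)%N) (M2_gt0 : (0 < #|M2|)%N).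
Variables (k s : 'I_K) (e : R).
Hypothesis ks : k != s.
Hypothesis decodes1 : forall j : 'I_K, j != k -> decodes W enc e j fst.
Hypothesis decodes2 : forall j : 'I_K, j != s -> decodes W enc e j snd.

Local Notation H := (entropy (code_law W enc)).
Local Notation L1 := (log_card M1).
Local Notation L2 := (log_card M2).
Local Notation cond_entropy := (cond_out_entropy W enc).
Local Notation view1 := (view (Y := Y) (n := n) (@fst M1 M2)).
Local Notation view2 := (view (Y := Y) (n := n) (@snd M1 M2)).

Let M_gt0 : (0 < #|{: M1 * M2}|)%N.
Proof. by rewrite card_prod muln_gt0 M1_gt0. Qed.

Lemma log_card_pair : log_card (M1 * M2)%type = L1 + L2.
Proof. by rewrite /log_card card_prod mult_INR log2_mult //; apply: INR_gt0. Qed.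

Lemma chain_rule2 j :
  H (view2 (full j)) = L2 + \sum_(i < n) cond_entropy j (view2 (past j i)) i.
Proof.
have -> : L2 = H (fun w => w.1.2).
  rewrite (entropy_message HW enc snd) (entropy_uniform M2_gt0) // => m.
  exact: image_law_uniform_snd.
by rewrite -(chain_rule HW enc); ring.
Qed.

Lemma rate2_converse (q : 'I_n -> {ffun 'I_n -> option 'I_K}) :
  (forall i : 'I_n, subpattern (past k i) (q i)) ->
  L2 * (1 - e) - 1 <= \sum_(i < n) mix_info (marg W k) (input_law W enc (view2 (q i)) i).
Proof.
move=> past_q; rewrite sum_mix_info_input_law.
have := entropy_view_full_le HW M_gt0 (decodes2 ks); rewrite chain_rule2.
have : \sum_(i < n) cond_entropy k (view2 (q i)) i <=
       \sum_(i < n) cond_entropy k (view2 (past k i)) i.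
  by apply: leR_sum => i _; apply: cond_out_entropy_subpattern.
by lra.
Qed.

Lemma sum_rate_converse j : j != k ->
  (L1 + L2) * (1 - e) - 2 <= H (view2 (full j)) - sum_noise_entropy W enc j
    + (sum_out_entropy W enc k - H (view2 (full k))).
Proof.
have inj12 : injective (fun m : M1 * M2 => (m.1, m.2)) by case=> [a b] [a' b'].
move=> /decodes1 dec1; have := sum_rate_le HW M_gt0 inj12 dec1 (decodes2 ks).
by rewrite log_card_pair; lra.
Qed.

Lemma sum_rate_converse_swap :
  (L1 + L2) * (1 - e) - 2 <= H (view1 (full k)) - sum_noise_entropy W enc k
    + (sum_out_entropy W enc s - H (view1 (full s))).
Proof.
have inj21 : injective (fun m : M1 * M2 => (m.2, m.1)) by case=> [a b] [a' b'] [-> ->].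
have sk : s != k by rewrite eq_sym.
have := sum_rate_le HW M_gt0 inj21 (decodes2 ks) (decodes1 sk).
by rewrite log_card_pair; lra.
Qed.

Lemma converse_more_capable :
  (forall j, j != k -> j != s -> more_capable W j s) -> more_capable W s k ->
  exists (U : finType) (p : U -> X -> R), is_pmf2 p /\
    rate_bounds (marg W) k s p (/ INR n * (L2 * (1 - e) - 1))
      (/ INR n * ((L1 + L2) * (1 - e) - 2)).
Proof.
move=> mc_s mc_k; have sk : s != k by rewrite eq_sym.
pose aux (i : 'I_n) := view2 (hybrid k s i).
have pmf_aux i : is_pmf2 (input_law W enc (aux i) i) by apply: pmf2_input_law.
exists _, (time_share (fun i => input_law W enc (aux i) i)).
split; first exact: pmf2_time_share.
apply: (rate_bounds_time_share (stochastic_marg HW) n_gt0 pmf_aux) => [|j jk|].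
- by apply: rate2_converse => i t; rewrite !ffunE; case: ifP; [right | left].
- have s_le_j : \sum_(i < n) \sum_v in_info (marg W s) (input_law W enc (aux i) i v) <=
                \sum_(i < n) \sum_v in_info (marg W j) (input_law W enc (aux i) i v).
    case: (eqVneq j s) => [->|js]; first exact: Rle_refl.
    apply: leR_sum => i _; apply: leR_sum => v _; apply: more_capable_in_info => //.
      exact: mc_s.
    by move=> x; apply: input_law_ge0.
  apply: Rle_trans (Rplus_le_compat_r _ _ _ s_le_j).
  have := csiszar_sum HW enc (@snd M1 M2) k s.
  have := sum_rate_converse sk; rewrite sum_in_info_input_law sum_mix_info_input_law.
  by rewrite /aux; lra.
- rewrite sum_in_info_letter_law; have := sum_rate_converse_swap.
  by have := full_view_more_capable HW enc M_gt0 (@fst M1 M2) mc_k; lra.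
Qed.

Lemma converse_less_noisy : (forall j, j != k -> less_noisy W j k) ->
  exists (U : finType) (p : U -> X -> R), is_pmf2 p /\
    rate_bounds (marg W) k s p (/ INR n * (L2 * (1 - e) - 1))
      (/ INR n * ((L1 + L2) * (1 - e) - 2)).
Proof.
move=> ln; have sk : s != k by rewrite eq_sym.
pose aux (i : 'I_n) := view2 (past k i).
have pmf_aux i : is_pmf2 (input_law W enc (aux i) i) by apply: pmf2_input_law.
exists _, (time_share (fun i => input_law W enc (aux i) i)).
have sum_rate j : j != k -> (L1 + L2) * (1 - e) - 2 <=
    \sum_(i < n) \sum_v in_info (marg W j) (input_law W enc (aux i) i v) +
    \sum_(i < n) mix_info (marg W k) (input_law W enc (aux i) i).
  move=> jk; have := sum_rate_converse jk; rewrite !chain_rule2.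
  have : \sum_(i < n) cond_entropy j (view2 (past j i)) i <=
         \sum_(i < n) cond_entropy j (view2 (past k i)) i.
    by apply: leR_sum => i _; apply: cond_out_entropy_past_less_noisy => //; apply: ln.
  by rewrite sum_in_info_input_law sum_mix_info_input_law /aux; lra.
split; first exact: pmf2_time_share.
apply: (rate_bounds_time_share (stochastic_marg HW) n_gt0 pmf_aux _ sum_rate).
  by apply: rate2_converse => i t; right.
apply: Rle_trans (sum_rate s sk) _; rewrite -big_split; apply: leR_sum => i _ /=.
rewrite -mix_info_in_info Rplus_comm; apply: Rplus_le_compat_r.
by apply: less_noisy_mix_info => [||v x]; [exact: HW | exact: ln | exact: input_law_ge0].
Qed.

End Converse.

(** * Codes *)

Lemma le_log2 x y : Rpower 2 x <= y -> x <= log2 y.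
Proof. by move=> xy; rewrite -(log2_Rpower x); apply: log2_le => //; apply: exp_pos. Qed.

Section Codes.
Variables (K : nat) (X : finType) (Y : 'I_K -> finType) (W : X -> outT Y -> R).
Hypothesis HW : is_channel W.

Section ErrorProbability.
Variables (n N1 N2 : nat) (c : code X Y n N1 N2).

Local Notation msg := ('I_N1 * 'I_N2)%type.

Definition codeword (m : msg) : {ffun 'I_n -> X} := [ffun t => enc c m.1 m.2 t].

Lemma PeE : Pe W c =
  \E_(m <- @uniform msg) \Pr_(y <- memoryless W (codeword m)) err_event c m.1 m.2 y.
Proof.
rewrite /expect sumR_pair /Pe /rsum /Rdiv -sumR_mulr; apply: eq_bigr => m1 _.
rewrite -sumR_mulr; apply: eq_bigr => m2 _; rewrite Rmult_comm.
rewrite /uniform card_prod !card_ord mult_INR; congr (_ * _); apply: eq_bigr => y _.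
by congr (_ * _); apply: eq_bigr => t _; rewrite ffunE.
Qed.

Hypotheses (N1_gt0 : (0 < N1)%N) (N2_gt0 : (0 < N2)%N).

Lemma msg_gt0 : (0 < #|{: msg}|)%N.
Proof. by rewrite card_prod !card_ord muln_gt0 N1_gt0. Qed.

Lemma Pe_code_law :
  Pe W c = \Pr_(w <- code_law W codeword) err_event c w.1.1 w.1.2 w.2.
Proof. by rewrite PeE expect_joint. Qed.

Lemma Pe_ge0 : 0 <= Pe W c.
Proof.
rewrite Pe_code_law; apply: expect_ge0 => w; last exact: indic_ge0.
exact/pmf_ge0/pmf_code_law/msg_gt0.
Qed.

Lemma Pe_le1 : Pe W c <= 1.
Proof.
have Hlaw := pmf_code_law HW codeword msg_gt0.
rewrite Pe_code_law -(expect_const 1 Hlaw); apply: leR_expect => w; last exact: indic_le1.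
exact: pmf_ge0.
Qed.

Lemma decodes_of_err_event j (T : finType) (A : msg -> T) (g : 'I_N1 * 'I_N2 -> T) :
  (forall m (y : {ffun 'I_n -> outT Y}),
     g (dec c j (fun t => y t j)) != A m -> err_event c m.1 m.2 y) ->
  decodes W codeword (Pe W c) j A.
Proof.
move=> err; exists (fun y => g (dec c j y)); rewrite Pe_code_law; apply: leR_expect => w.
  exact/pmf_ge0/pmf_code_law/msg_gt0.
have -> : fun_of_fin [ffun t => w.2 t j] = (fun t => w.2 t j).
  by apply: funext => t; rewrite ffunE.
case: eqP => [_|/eqP /err ->]; [exact: indic_ge0 | exact: Rle_refl].
Qed.

Lemma decodes_fst j : req1 j -> decodes W codeword (Pe W c) j fst.
Proof.
move=> r1; apply: (decodes_of_err_event (g := fst)) => m y wrong.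
by apply/existsP; exists j; rewrite r1 wrong.
Qed.

Lemma decodes_snd j : req2 j -> decodes W codeword (Pe W c) j snd.
Proof.
move=> r2; apply: (decodes_of_err_event (g := snd)) => m y wrong.
by apply/existsP; exists j; rewrite r2 wrong orbT.
Qed.

End ErrorProbability.

Variables (k s : 'I_K).
Hypotheses (rcv_k : rcv k = K) (rcv_s : rcv s = K.-1).
Hypothesis Hclass : classA W \/ classB W.

Lemma last_receivers_neq : k != s.
Proof.
apply/eqP => ks; have := ltn_predK (ltn_ord k).
by rewrite -rcv_s -ks rcv_k => /eqP; rewrite eqn_leq ltnn.
Qed.

Lemma converse_code n N1 N2 (c : code X Y n N1 N2) :
  (0 < n)%N -> (0 < N1)%N -> (0 < N2)%N ->
  exists (U : finType) (p : U -> X -> R), is_pmf2 p /\ rate_bounds (marg W) k s p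
    (/ INR n * (log2 (INR N2) * (1 - Pe W c) - 1))
    (/ INR n * ((log2 (INR N1) + log2 (INR N2)) * (1 - Pe W c) - 2)).
Proof.
move=> n0 N10 N20; have ks := last_receivers_neq.
have dec1 j : j != k -> decodes W (codeword c) (Pe W c) j fst.
  by move=> jk; apply: decodes_fst; rewrite ?(req1E rcv_k).
have dec2 j : j != s -> decodes W (codeword c) (Pe W c) j snd.
  by move=> js; apply: decodes_snd; rewrite ?(req2E rcv_s).
have logE N : log2 (INR N) = log_card 'I_N by rewrite /log_card card_ord.
rewrite !logE.
have M1_gt0 : (0 < #|'I_N1|)%N by rewrite card_ord.
have M2_gt0 : (0 < #|'I_N2|)%N by rewrite card_ord.
case: Hclass => [/(classA_more_capable rcv_k rcv_s)[mc_s mc_k]|/(classB_less_noisy rcv_k) ln].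
  exact: (converse_more_capable HW n0 M1_gt0 M2_gt0 ks dec1 dec2 mc_s mc_k).
exact: (converse_less_noisy HW n0 M1_gt0 M2_gt0 ks dec1 dec2 ln).
Qed.

Lemma achievable_rate_bounds R1 R2 d : achievable W R1 R2 -> 0 < d ->
  exists (U : finType) (p : U -> X -> R),
    is_pmf2 p /\ rate_bounds (marg W) k s p (R2 - d) (R2 + R1 - d).
Proof.
move=> [R1_ge0 [R2_ge0 [N1 [N2 [c [N1_ge [N2_ge Pe_cv]]]]]]] d0.
have card_gt0 N x : Rpower 2 x <= INR N -> (0 < N)%N.
  by case: N => //= le0; have : 0 < Rpower 2 x := exp_pos _; lra.
have cv : Un_cv (fun n => Pe W (c n) * (R1 + R2) + / INR n * 2) 0.
  rewrite -[0]Rplus_0_r -{1}(Rmult_0_l (R1 + R2)) -{2}(Rmult_0_l 2).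
  by apply: CV_plus; apply: Un_cv_mulr => //; apply: Un_cv_inv_INR.
have [N small] := cv d d0; pose n := N.+1; have n0 : 0 < INR n by apply: INR_gt0.
have {}small : Pe W (c n) * (R1 + R2) + / INR n * 2 < d.
  by apply: Rle_lt_trans (small n (le_S _ _ (le_n N))); rewrite /Rdist Rminus_0_r; apply: Rle_abs.
have N1_gt0 := card_gt0 _ _ (N1_ge n); have N2_gt0 := card_gt0 _ _ (N2_ge n).
have [U [p [Hp bounds]]] := converse_code (c n) (ltn0Sn N) N1_gt0 N2_gt0.
have e0 := Pe_ge0 (c n) N1_gt0 N2_gt0; have e1 := Pe_le1 (c n) N1_gt0 N2_gt0.
have inv_n : 0 < / INR n by apply: Rinv_0_lt_compat.
have per_letter r x y : INR n * r <= x ->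
    r * (1 - Pe W (c n)) - / INR n * y <= / INR n * (x * (1 - Pe W (c n)) - y).
  move=> rx; rewrite [X in _ <= X]Rmult_minus_distr_l; apply: Rplus_le_compat_r.
  have -> : r = / INR n * (INR n * r) by field; lra.
  rewrite Rmult_assoc; apply: Rmult_le_compat_l; first lra.
  by apply: Rmult_le_compat_r; lra.
have log_N2 := le_log2 (N2_ge n); have log_N1 := le_log2 (N1_ge n).
exists U, p; split=> //; apply: rate_bounds_le bounds.
  apply: Rle_trans (per_letter R2 _ 1 log_N2).
  by have : 0 <= R1 * Pe W (c n) by [apply: Rmult_le_pos]; lra.
apply: Rle_trans (per_letter (R1 + R2) _ 2 _); first lra.
by rewrite Rmult_plus_distr_l; lra.
Qed.

End Codes.

(** * Threshold decoding *)

Definition exceeds (g r v : R) : bool := ltRb (g * r) v.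

Definition threshold_decode (M : finType) (test : pred M) (d : M) : M := odflt d [pick m | test m].

Lemma indic_decode_le (M : finType) (test : pred M) (d m : M) :
  indic (threshold_decode test d != m) <=
  indic (~~ test m) + \sum_(m' | m' != m) indic (test m').
Proof.
have alarms_ge0 : 0 <= \sum_(m' | m' != m) indic (test m').
  by apply: sumR_ge0 => m' _; apply: indic_ge0.
case test_m: (test m); last first.
  by apply: Rle_trans (indic_le1 _) _; rewrite [indic (~~ _)]/=; lra.
rewrite [indic (~~ true)]/= Rplus_0_l /threshold_decode.
case: pickP => [m1 test_m1|/(_ m)]; last by rewrite test_m.
rewrite [odflt _ _]/=; case: eqP => [_|/eqP m1m]; first exact: alarms_ge0.
apply: Rle_trans (leR_sum_term_cond (F := fun m' => indic (test m')) m1m _) => [|m' _].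
  by rewrite test_m1; apply: Rle_refl.
exact: indic_ge0.
Qed.

Lemma decode_error_le (A M : finType) (P : A -> R) (test : A -> pred M) (d m : M) :
  (forall a, 0 <= P a) ->
  \Pr_(a <- P) (threshold_decode (test a) d != m) <=
  \Pr_(a <- P) (~~ test a m) + \sum_(m' | m' != m) \Pr_(a <- P) test a m'.
Proof.
move=> P0; rewrite -expect_sum -expectD; apply: leR_expect => // a.
exact: indic_decode_le.
Qed.

(* Change of measure: where [nu] exceeds [g] times [mu], the [mu]-mass is at most [1/g] times the
   [nu]-mass. *)
Lemma false_alarm (B : finType) (mu nu : B -> R) g :
  0 < g -> (forall b, 0 <= mu b) -> is_pmf nu ->
  \Pr_(b <- mu) exceeds g (mu b) (nu b) <= / g.
Proof.
move=> g0 mu0 Hnu; rewrite -[/ g]Rmult_1_r -(pmf_sum1 Hnu) -sumR_mull.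
apply: leR_sum => b _; apply: (Rmult_le_reg_l g) => //.
rewrite -[X in _ <= X]Rmult_assoc Rinv_r ?Rmult_1_l; last lra.
have := pmf_ge0 Hnu b; have := mu0 b.
by rewrite /exceeds /indic; case: ltRbP => ? ? ?; lra.
Qed.

(** * Superposition coding *)

Section Superposition.
Variables (M0 Mp CU CX CY : finType).
Variables (PU : CU -> R) (Q : CU -> CX -> R) (V : CX -> CY -> R).
Hypotheses (HPU : is_pmf PU) (HQ : stochastic Q) (HV : stochastic V).

Local Notation cloud := (CU * {ffun Mp -> CX})%type.
Local Notation codebook := {ffun M0 -> cloud}.

Definition cloud_law : cloud -> R := joint_law PU (fun u => iid (Q u)).

Definition codebook_law : codebook -> R := iid cloud_law.

Definition center (w : codebook) (m0 : M0) : CU := (w m0).1.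

Definition satellite (w : codebook) (m : M0 * Mp) : CX := (w m.1).2 m.2.

Definition sent_law (m : M0 * Mp) : codebook * CY -> R :=
  joint_law codebook_law (fun w => V (satellite w m)).

Definition center_output (u : CU) : CY -> R := output (Q u) V.

Definition blind_output : CY -> R := output PU center_output.

Lemma pmf_cloud_law : is_pmf cloud_law.
Proof. by apply: pmf_joint => // u; apply: pmf_iid. Qed.

Lemma pmf_codebook_law : is_pmf codebook_law.
Proof. exact: pmf_iid pmf_cloud_law. Qed.

Lemma pmf_sent_law m : is_pmf (sent_law m).
Proof. by apply: pmf_joint => [|w]; [apply: pmf_codebook_law | apply: HV]. Qed.

Lemma expect_cloud1 i (g : CU -> CX -> R) :
  \E_(b <- cloud_law) g b.1 (b.2 i) = \E_(u <- PU) \E_(x <- Q u) g u x.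
Proof.
rewrite expect_joint; apply: eq_expect => u.
by rewrite (expect_prod_law1 (fun=> HQ u) i (g u)).
Qed.

Lemma expect_cloud2 i i' (g : CU -> CX -> CX -> R) : i != i' ->
  \E_(b <- cloud_law) g b.1 (b.2 i) (b.2 i') =
  \E_(u <- PU) \E_(x <- Q u) \E_(x' <- Q u) g u x x'.
Proof.
move=> ii'; rewrite expect_joint; apply: eq_expect => u.
by rewrite (expect_prod_law2 (fun=> HQ u) (g u) ii').
Qed.

Section Sent.
Variables (m : M0 * Mp) (g : CU -> CX -> CY -> R).

Lemma expect_sent :
  \E_(a <- sent_law m) g (center a.1 m.1) (satellite a.1 m) a.2 =
  \E_(u <- PU) \E_(x <- Q u) \E_(y <- V x) g u x y.
Proof.
rewrite expect_joint /center /satellite /=.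
rewrite (expect_prod_law1 (fun=> pmf_cloud_law) m.1
  (fun b => \E_(y <- V (b.2 m.2)) g b.1 (b.2 m.2) y)).
exact: (expect_cloud1 m.2 (fun u x => \E_(y <- V x) g u x y)).
Qed.

Lemma expect_sent_same_cloud i : i != m.2 ->
  \E_(a <- sent_law m) g (center a.1 m.1) (satellite a.1 (m.1, i)) a.2 =
  \E_(u <- PU) \E_(x <- Q u) \E_(y <- center_output u) g u x y.
Proof.
rewrite eq_sym => mi; rewrite expect_joint /center /satellite /=.
rewrite (expect_prod_law1 (fun=> pmf_cloud_law) m.1
  (fun b => \E_(y <- V (b.2 m.2)) g b.1 (b.2 i) y)).
rewrite (expect_cloud2 (fun u x x' => \E_(y <- V x) g u x' y) mi).
apply: eq_expect => u; rewrite expect_exchange; apply: eq_expect => x'.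
by rewrite -expect_output.
Qed.

Lemma expect_sent_other_cloud m' : m'.1 != m.1 ->
  \E_(a <- sent_law m) g (center a.1 m'.1) (satellite a.1 m') a.2 =
  \E_(u <- PU) \E_(x <- Q u) \E_(y <- blind_output) g u x y.
Proof.
rewrite eq_sym => mm'; rewrite expect_joint /center /satellite /=.
rewrite (expect_prod_law2 (fun=> pmf_cloud_law)
  (fun b b' => \E_(y <- V (b.2 m.2)) g b'.1 (b'.2 m'.2) y) mm').
rewrite expect_exchange -(expect_cloud1 m'.2 (fun u x => \E_(y <- blind_output) g u x y)).
apply: eq_expect => b'; rewrite (expect_cloud1 m.2
  (fun _ x => \E_(y <- V x) g b'.1 (b'.2 m'.2) y)) expect_output.
by apply: eq_expect => u; rewrite expect_output.
Qed.

End Sent.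

Section CloudDecoding.
Variable g : R.
Hypothesis g_gt0 : 0 < g.

Definition cloud_test (u : CU) (y : CY) : bool := exceeds g (blind_output y) (center_output u y).

Definition cloud_decode (d : M0) (w : codebook) (y : CY) : M0 :=
  threshold_decode (fun m0 => cloud_test (center w m0) y) d.

Definition cloud_miss : R := \E_(u <- PU) \E_(x <- Q u) \Pr_(y <- V x) (~~ cloud_test u y).

Lemma cloud_decode_error d m :
  \Pr_(a <- sent_law m) (cloud_decode d a.1 a.2 != m.1) <= cloud_miss + INR #|M0|.-1 * / g.
Proof.
apply: Rle_trans (decode_error_le _ _ _ (pmf_ge0 (pmf_sent_law m))) _.
apply: Rplus_le_compat.
  by apply: Req_le; apply: (expect_sent m (fun u _ y => indic (~~ cloud_test u y))).
rewrite -(sumR_const_neq m.1); apply: leR_sum => m0 m0m.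
rewrite (expect_sent_other_cloud (fun u _ y => indic (cloud_test u y)) (m' := (m0, m.2)) m0m).
rewrite -(expect_const (/ g) HPU); apply: leR_expect => [|u]; first exact: pmf_ge0.
rewrite (expect_const _ (HQ u)); apply: false_alarm => // [y|].
  by apply: output_ge0 => [|u']; [apply: pmf_ge0 | apply: pmf_output].
exact: pmf_output.
Qed.

End CloudDecoding.

Section SatelliteDecoding.
Variables (g1 g2 : R).
Hypotheses (g1_gt0 : 0 < g1) (g2_gt0 : 0 < g2).

Definition satellite_test (u : CU) (x : CX) (y : CY) : bool :=
  exceeds g1 (center_output u y) (V x y) && exceeds g2 (blind_output y) (V x y).

Definition satellite_decode (d : M0 * Mp) (w : codebook) (y : CY) : M0 * Mp :=
  threshold_decode (fun m => satellite_test (center w m.1) (satellite w m) y) d.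

Definition satellite_miss : R :=
  \E_(u <- PU) \E_(x <- Q u) \Pr_(y <- V x) (~~ satellite_test u x y).

Lemma satellite_false_alarm (mu : CU -> CY -> R) g :
  0 < g -> (forall u y, 0 <= mu u y) ->
  (forall u x y, satellite_test u x y -> exceeds g (mu u y) (V x y)) ->
  \E_(u <- PU) \E_(x <- Q u) \Pr_(y <- mu u) satellite_test u x y <= / g.
Proof.
move=> g0 mu0 test_g; rewrite -(expect_const (/ g) HPU).
apply: leR_expect => [|u]; first exact: pmf_ge0.
rewrite -(expect_const (/ g) (HQ u)); apply: leR_expect => [|x]; first exact: pmf_ge0.
apply: Rle_trans (false_alarm g0 (mu0 u) (HV x)); apply: leR_expect => // y.
by case test: satellite_test; [rewrite (test_g _ _ _ test); apply: Rle_refl | apply: indic_ge0].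
Qed.

Lemma satellite_decode_error d m :
  \Pr_(a <- sent_law m) (satellite_decode d a.1 a.2 != m) <=
  satellite_miss + (INR #|Mp|.-1 * / g1 + INR #|M0|.-1 * (INR #|Mp| * / g2)).
Proof.
pose test u x y := indic (satellite_test u x y).
have center0 u y : 0 <= center_output u y by apply: pmf_ge0; apply: pmf_output.
have blind0 y : 0 <= blind_output y.
  by apply: output_ge0 => [|u]; [apply: pmf_ge0 | apply: pmf_output].
apply: Rle_trans (decode_error_le _ _ _ (pmf_ge0 (pmf_sent_law m))) _.
apply: Rplus_le_compat.
  by apply: Req_le; apply: (expect_sent m (fun u x y => indic (~~ satellite_test u x y))).
rewrite sumR_pair_neq -(sumR_const_neq m.2) -(sumR_const_neq m.1) -sumR_const.
apply: Rplus_le_compat; apply: leR_sum => i im; last apply: leR_sum => j _.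
  rewrite (expect_sent_same_cloud test im); apply: satellite_false_alarm => // u x y.
  by case/andP.
rewrite (@expect_sent_other_cloud m test (i, j) im).
by apply: (satellite_false_alarm (mu := fun=> blind_output)) => // u x y; case/andP.
Qed.

End SatelliteDecoding.
End Superposition.

(** * Chebyshev's inequality for information densities *)

Definition variance (A : finType) (P g : A -> R) : R := \E_(a <- P) Rsqr (g a - \E_(b <- P) g b).

Section Chebyshev.
Variables (A : finType) (P : A -> R).
Hypothesis HP : is_pmf P.

Lemma variance_ge0 g : 0 <= variance P g.
Proof. by apply: expect_ge0 => a; [apply: pmf_ge0 | apply: Rle_0_sqr]. Qed.

Lemma variance_iid_sum n (g : A -> R) :
  \E_(f <- @iid 'I_n A P) Rsqr (\sum_t (g (f t) - \E_(b <- P) g b)) = INR n * variance P g.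
Proof.
pose h a := g a - \E_(b <- P) g b.
have h_mean : \E_(a <- P) h a = 0.
  rewrite expectD (expect_const _ HP); ring.
transitivity (\sum_(t < n) \sum_(s < n) \E_(f <- @iid 'I_n A P) (h (f t) * h (f s))).
  under [RHS]eq_bigr => t _ do rewrite -expect_sum.
  rewrite -expect_sum; apply: eq_expect => f; rewrite /Rsqr -sumR_mulr.
  by apply: eq_bigr => t _; rewrite -sumR_mull.
have -> : INR n * variance P g = \sum_(t < n) variance P g by rewrite sumR_const card_ord.
apply: eq_bigr => t _; rewrite (bigD1 t) //= big1 ?Rplus_0_r => [|s st].
  exact: (expect_prod_law1 (fun=> HP) t (fun a => h a * h a)).
rewrite eq_sym in st; rewrite (expect_prod_law2 (fun=> HP) (fun a b => h a * h b) st).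
by under eq_expect => a do rewrite expectMl h_mean Rmult_0_r; rewrite (expect_const _ HP).
Qed.

Lemma chebyshev n (g : A -> R) d : (0 < n)%N -> 0 < d ->
  \Pr_(f <- @iid 'I_n A P) (~~ ltRb (INR n * (\E_(a <- P) g a - d)) (\sum_t g (f t)))
  <= variance P g / (d * d) / INR n.
Proof.
move=> /INR_gt0 n0 d0; have nd : 0 < INR n * d by apply: Rmult_lt_0_compat.
have nd2 : 0 < Rsqr (INR n * d) by apply: Rlt_0_sqr; lra.
have -> : variance P g / (d * d) / INR n = INR n * variance P g * / Rsqr (INR n * d).
  by rewrite /Rsqr; field; lra.
rewrite -variance_iid_sum -expectMr; apply: leR_expect => f.
  exact/pmf_ge0/pmf_iid.
rewrite sumRB sumR_const card_ord; apply: (Rmult_le_reg_r (Rsqr (INR n * d))) => //.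
rewrite [X in _ <= X]Rmult_assoc Rinv_l ?Rmult_1_r; last lra.
rewrite /indic; case: ltRbP => [_|low]; first by rewrite Rmult_0_l; apply: Rle_0_sqr.
by rewrite Rmult_1_l [X in _ <= X]Rsqr_neg; apply: Rsqr_incr_1; lra.
Qed.

Lemma information_spectrum n (v r : A -> R) d : (0 < n)%N -> 0 < d ->
  (forall a, 0 < P a -> 0 < v a /\ 0 < r a) ->
  \Pr_(f <- @iid 'I_n A P)
    (~~ exceeds (Rpower 2 (INR n * (\E_(a <- P) log2 (v a / r a) - d))) (iid r f) (iid v f))
  <= variance P (fun a => log2 (v a / r a)) / (d * d) / INR n.
Proof.
move=> n0 d0 vr0; apply: Rle_trans (chebyshev _ n0 d0); rewrite /expect.
apply: leR_sum => f _; have iid0 := pmf_ge0 (pmf_iid _ HP) f; case: iid0 => [fP|<-]; last lra.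
have Pf t : 0 < P (f t).
  have [//|Pft] := pmf_ge0 HP (f t); move: fP; rewrite /iid /prod_law.
  by rewrite (@prodR_eq0 _ _ t); lra.
have v0 t : 0 < v (f t) by case: (vr0 _ (Pf t)).
have r0 t : 0 < r (f t) by case: (vr0 _ (Pf t)).
apply: Rmult_le_compat_l; first lra.
rewrite /exceeds; case: ltRbP => [_|/Rnot_lt_le low]; first exact: indic_ge0.
have := log2_le (prodR_gt0 v0) low.
rewrite log2_mult ?log2_Rpower; [|exact: exp_pos|exact: prodR_gt0].
rewrite /iid /prod_law !log2_prod // => log_low.
have -> : \sum_t log2 (v (f t) / r (f t)) = \sum_t log2 (v (f t)) - \sum_t log2 (r (f t)).
  by rewrite -sumRB; apply: eq_bigr => t _; rewrite log2_div.
by case: ltRbP => [|_]; [lra | apply: Rle_refl].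
Qed.

End Chebyshev.

(** * Information densities of memoryless superposition codes *)

Lemma in_info_density (X B : finType) (V : X -> B -> R) (q : X -> R) :
  is_pmf q -> stochastic V ->
  in_info V q = \E_(x <- q) \E_(b <- V x) log2 (V x b / output q V b).
Proof.
move=> Hq HV; have q0 := pmf_ge0 Hq.
have splitE : \E_(x <- q) \E_(b <- V x) log2 (V x b / output q V b) =
    \E_(x <- q) \E_(b <- V x) (log2 (V x b) - log2 (output q V b)).
  apply: eq_expect_pos => // x qx; apply: eq_expect_pos => [b|b Vxb]; first exact: pmf_ge0.
  rewrite log2_div //; apply: Rlt_le_trans (Rmult_lt_0_compat _ _ qx Vxb) _.
  by apply: (@leR_sum_term _ (fun x => q x * V x b)) => x'; apply/Rmult_le_pos/pmf_ge0.
rewrite splitE; under eq_expect => x do rewrite expectD expectN.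
rewrite expectD expectN -(expect_output q V (fun b => log2 (output q V b))).
rewrite /in_info /out_entropy pmf_sum1 // xlog1 /noise_entropy expectN.
by rewrite {2 3}/expect /xlog /expect; ring.
Qed.

Lemma expect_prod_law_memoryless (I A B : finType) (mu : I -> A -> R) (V : A -> B -> R)
    (F : {ffun I -> A} -> {ffun I -> B} -> R) :
  \E_(a <- prod_law mu) \E_(b <- memoryless V a) F a b =
  \E_(f <- prod_law (fun i => joint_law (mu i) V)) F [ffun i => (f i).1] [ffun i => (f i).2].
Proof.
pose merge (ab : {ffun I -> A} * {ffun I -> B}) : {ffun I -> A * B} :=
  [ffun i => (ab.1 i, ab.2 i)].
rewrite -(expect_joint (prod_law mu) (memoryless V) (fun ab => F ab.1 ab.2)) /expect.
rewrite [RHS](reindex merge) /=.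
  apply: eq_bigr => -[a b] _; rewrite /joint_law /memoryless /prod_law -big_split /=.
  congr (_ * _); first by apply: eq_bigr => i _; rewrite ffunE.
  by congr F; apply/ffunP => i; rewrite !ffunE.
exists (fun f => ([ffun i => (f i).1], [ffun i => (f i).2])) => [[a b]|f] _ /=.
  by congr pair; apply/ffunP => i; rewrite !ffunE.
by apply/ffunP => i; rewrite !ffunE -surjective_pairing.
Qed.

Section Densities.
Variables (U X B : finType) (PU : U -> R) (Q : U -> X -> R) (V : X -> B -> R).
Hypotheses (HPU : is_pmf PU) (HQ : stochastic Q) (HV : stochastic V).

Definition triple_law : U * X * B -> R := joint_law (joint_law PU Q) (fun ux => V ux.2).

Definition center_density (a : U * X * B) : R :=
  log2 (center_output Q V a.1.1 a.2 / blind_output PU Q V a.2).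

Definition satellite_density (a : U * X * B) : R :=
  log2 (V a.1.2 a.2 / center_output Q V a.1.1 a.2).

Definition codeword_density (a : U * X * B) : R := log2 (V a.1.2 a.2 / blind_output PU Q V a.2).

Lemma pmf_triple_law : is_pmf triple_law.
Proof. by apply: pmf_joint => [|ux]; [apply: pmf_joint | apply: HV]. Qed.

Lemma expect_triple_law F :
  \E_(a <- triple_law) F a = \E_(u <- PU) \E_(x <- Q u) \E_(y <- V x) F (u, x, y).
Proof. by rewrite !expect_joint. Qed.

Lemma expect_center_density :
  \E_(a <- triple_law) center_density a = in_info (center_output Q V) PU.
Proof.
rewrite in_info_density //; last exact: stochastic_output.
by rewrite expect_triple_law; apply: eq_expect => u; rewrite expect_output.
Qed.

Lemma expect_satellite_density :
  \E_(a <- triple_law) satellite_density a = \E_(u <- PU) in_info V (Q u).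
Proof. by rewrite expect_triple_law; apply: eq_expect => u; rewrite in_info_density. Qed.

Lemma expect_codeword_density :
  \E_(a <- triple_law) codeword_density a = in_info V (output PU Q).
Proof.
rewrite in_info_density //; last exact: pmf_output.
rewrite expect_output expect_triple_law; apply: eq_expect => u; apply: eq_expect => x.
by apply: eq_expect => y; rewrite /codeword_density /blind_output /output expect_output.
Qed.

Lemma triple_law_gt0 a : 0 < triple_law a ->
  [/\ 0 < V a.1.2 a.2, 0 < center_output Q V a.1.1 a.2 & 0 < blind_output PU Q V a.2].
Proof.
case: a => [[u x] y]; rewrite /triple_law /joint_law /= => uxy.
have PU0 := pmf_ge0 HPU; have Q0 u := pmf_ge0 (HQ u); have V0 x := pmf_ge0 (HV x).
have pos (r r' : R) : 0 <= r -> 0 <= r' -> 0 < r * r' -> 0 < r /\ 0 < r'.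
  by case=> [r0|<-]; [case=> [r'0|<-] // | ]; rewrite ?Rmult_0_l ?Rmult_0_r; lra.
have [/pos - /(_ (PU0 u) (Q0 u x)) [u0 x0] y0] :=
  pos _ _ (Rmult_le_pos _ _ (PU0 u) (Q0 u x)) (V0 x y) uxy.
have center0 u' y' : 0 <= center_output Q V u' y' by apply: expect_ge0.
have center_gt0 : 0 < center_output Q V u y.
  apply: Rlt_le_trans (Rmult_lt_0_compat _ _ x0 y0) _.
  by apply: (@leR_sum_term _ (fun x => Q u x * V x y)) => x'; apply: Rmult_le_pos.
split=> //; apply: Rlt_le_trans (Rmult_lt_0_compat _ _ u0 center_gt0) _.
by apply: (@leR_sum_term _ (fun u => PU u * center_output Q V u y)) => u'; apply: Rmult_le_pos.
Qed.

Variable n : nat.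
Hypothesis n_gt0 : (0 < n)%N.

Local Notation PUn := (@iid 'I_n U PU).
Local Notation Qn := (@memoryless 'I_n U X Q).
Local Notation Vn := (@memoryless 'I_n X B V).

Lemma expect_iid_triple (F : {ffun 'I_n -> U} -> {ffun 'I_n -> X} -> {ffun 'I_n -> B} -> R) :
  \E_(u <- PUn) \E_(x <- Qn u) \E_(y <- Vn x) F u x y =
  \E_(f <- iid triple_law) F [ffun t => (f t).1.1] [ffun t => (f t).1.2] [ffun t => (f t).2].
Proof.
rewrite (expect_prod_law_memoryless (fun=> PU) Q (fun u x => \E_(y <- Vn x) F u x y)).
transitivity (\E_(ux <- iid (joint_law PU Q)) \E_(y <- memoryless (fun ux => V ux.2) ux)
    F [ffun t => (ux t).1] [ffun t => (ux t).2] y).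
  apply: eq_expect => ux; congr expect; apply: funext => y.
  by apply: eq_bigr => t _; rewrite ffunE.
rewrite (expect_prod_law_memoryless (fun=> joint_law PU Q) (fun ux => V ux.2)
  (fun ux y => F [ffun t => (ux t).1] [ffun t => (ux t).2] y)).
by apply: eq_expect => f; congr F; apply/ffunP => t; rewrite !ffunE.
Qed.

Lemma center_output_memoryless u y :
  center_output Qn Vn u y = memoryless (center_output Q V) u y.
Proof. exact: output_prod_law. Qed.

Lemma blind_output_memoryless y : blind_output PUn Qn Vn y = iid (blind_output PU Q V) y.
Proof.
transitivity (output PUn (memoryless (center_output Q V)) y); last exact: output_prod_law.
by apply: eq_expect => u; apply: center_output_memoryless.
Qed.

Lemma cloud_miss_le d : 0 < d ->
  cloud_miss PUn Qn Vn (Rpower 2 (INR n * (in_info (center_output Q V) PU - d)))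
  <= variance triple_law center_density / (d * d) / INR n.
Proof.
move=> d0; have := information_spectrum pmf_triple_law n_gt0 d0
  (v := fun a => center_output Q V a.1.1 a.2) (r := fun a => blind_output PU Q V a.2).
rewrite -/center_density expect_center_density => spectrum.
apply: Rle_trans (spectrum _); last by move=> a /triple_law_gt0[].
rewrite /cloud_miss; set g := Rpower 2 _.
rewrite (expect_iid_triple (fun u _ y => indic (~~ cloud_test PUn Qn Vn g u y))).
apply: Req_le; apply: eq_expect => f.
rewrite /cloud_test center_output_memoryless blind_output_memoryless.
congr (indic (~~ exceeds _ _ _)).
  by apply: eq_bigr => t _; rewrite ffunE.
by apply: eq_bigr => t _; rewrite !ffunE.
Qed.

Lemma satellite_miss_le d : 0 < d ->
  satellite_miss PUn Qn Vn (Rpower 2 (INR n * ((\E_(u <- PU) in_info V (Q u)) - d)))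
    (Rpower 2 (INR n * (in_info V (output PU Q) - d)))
  <= (variance triple_law satellite_density + variance triple_law codeword_density)
     / (d * d) / INR n.
Proof.
move=> d0; have := information_spectrum pmf_triple_law n_gt0 d0
  (v := fun a => V a.1.2 a.2) (r := fun a => center_output Q V a.1.1 a.2).
have := information_spectrum pmf_triple_law n_gt0 d0
  (v := fun a => V a.1.2 a.2) (r := fun a => blind_output PU Q V a.2).
rewrite -/codeword_density expect_codeword_density -/satellite_density expect_satellite_density.
have pos a (pos_a : 0 < triple_law a) := triple_law_gt0 pos_a.
move=> spectrum2 spectrum1; rewrite !Rdiv_plus_distr.
apply: Rle_trans (Rplus_le_compat _ _ _ _ (spectrum1 _) (spectrum2 _)); first last.
- by move=> a /pos[].
- by move=> a /pos[].
rewrite /satellite_miss; set g1 := Rpower 2 _; set g2 := Rpower 2 _.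
rewrite (expect_iid_triple (fun u x y => indic (~~ satellite_test PUn Qn Vn g1 g2 u x y))).
rewrite -expectD; apply: leR_expect => f; first exact/pmf_ge0/pmf_iid/pmf_triple_law.
rewrite /satellite_test center_output_memoryless blind_output_memoryless negb_and.
have -> : memoryless V [ffun t => (f t).1.2] [ffun t => (f t).2] =
    iid (fun a : U * X * B => V a.1.2 a.2) f by apply: eq_bigr => t _; rewrite !ffunE.
have -> : memoryless (center_output Q V) [ffun t => (f t).1.1] [ffun t => (f t).2] =
    iid (fun a : U * X * B => center_output Q V a.1.1 a.2) f.
  by apply: eq_bigr => t _; rewrite !ffunE.
have -> : iid (blind_output PU Q V) [ffun t => (f t).2] =
    iid (fun a : U * X * B => blind_output PU Q V a.2) f by apply: eq_bigr => t _; rewrite !ffunE.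
by rewrite /indic; case: (~~ _); case: (~~ _); rewrite /=; lra.
Qed.

End Densities.

(** * Random superposition codes for the broadcast channel *)

Section Disintegration.
Variables (U X : finType) (p : U -> X -> R) (PU : U -> R) (Q : U -> X -> R).
Hypotheses (HPU : is_pmf PU) (HQ : stochastic Q).
Hypothesis pE : forall u x, PU u * Q u x = p u x.

Lemma output_disintegration : output PU Q = mixture p.
Proof. by apply: funext => x; apply: eq_bigr => u _. Qed.

Variables (B : finType) (V : X -> B -> R).
Hypothesis HV : stochastic V.

Let pZ u : p u = (fun x => PU u * Q u x).
Proof. by apply: funext => x; rewrite pE. Qed.

Lemma in_info_disintegration : \E_(u <- PU) in_info V (Q u) = \sum_u in_info V (p u).
Proof.
by apply: eq_bigr => u _; rewrite pZ in_infoZ //; [apply: pmf_ge0 | apply: pmf_ge0].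
Qed.

Lemma mix_info_disintegration : in_info (center_output Q V) PU = mix_info V p.
Proof.
have Hmix : is_pmf (mixture p) by rewrite -output_disintegration; apply: pmf_output.
have out_mix b : output PU (center_output Q V) b = output (mixture p) V b.
  by rewrite -output_disintegration [RHS]expect_output.
rewrite /in_info /mix_info {1 2}/out_entropy (pmf_sum1 HPU) (pmf_sum1 Hmix).
rewrite (eq_bigr _ (fun b _ => congr1 xlog (out_mix b))); congr (_ - _).
apply: eq_bigr => u _; rewrite pZ out_entropyZ //; [|exact: pmf_ge0|exact: pmf_ge0].
by rewrite /out_entropy (pmf_sum1 (HQ u)) xlog1 /noise_entropy /center_output; ring.
Qed.

End Disintegration.

Lemma disintegration (U X : finType) (p : U -> X -> R) : is_pmf2 p ->
  exists (PU : U -> R) (Q : U -> X -> R),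
    [/\ is_pmf PU, stochastic Q & forall u x, PU u * Q u x = p u x].
Proof.
move=> Hp; have [p0 p1] := Hp; pose PU u := \sum_x p u x.
have PU0 u : 0 <= PU u by apply: sumR_ge0.
(* Where [PU u = 0] any pmf will do. *)
exists PU, (fun u x => if Req_dec_T (PU u) 0 then mixture p x else p u x / PU u).
split=> [//|u|u x].
  case: Req_dec_T => [_|PUu] /=; first exact: pmf_mixture.
  split=> [x|]; last by rewrite /rsum sumR_mulr Rinv_r.
  by apply: Rmult_le_pos => //; apply/Rlt_le/Rinv_0_lt_compat; have := PU0 u; lra.
case: Req_dec_T => [PUu|PUu] /=; last by field.
by rewrite PUu Rmult_0_l (sumR_eq0 (p0 u) PUu).
Qed.

Section RandomCode.
Variables (K : nat) (X : finType) (Y : 'I_K -> finType) (W : X -> outT Y -> R).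
Hypothesis HW : is_channel W.
Variables (U : finType) (PU : U -> R) (Q : U -> X -> R).
Hypotheses (HPU : is_pmf PU) (HQ : stochastic Q).
Variables (k : 'I_K) (delta : R).
Hypotheses (rcv_k : rcv k = K) (delta_gt0 : 0 < delta).

Definition center_rate (j : 'I_K) : R := in_info (center_output Q (marg W j)) PU.
Definition satellite_rate (j : 'I_K) : R := \E_(u <- PU) in_info (marg W j) (Q u).
Definition codeword_rate (j : 'I_K) : R := in_info (marg W j) (output PU Q).

Definition spread (j : 'I_K) : R :=
  variance (triple_law PU Q (marg W j)) (center_density PU Q (marg W j)) +
  (variance (triple_law PU Q (marg W j)) (satellite_density Q (marg W j)) +
   variance (triple_law PU Q (marg W j)) (codeword_density PU Q (marg W j))).

Variables (n a b d : nat).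
Hypothesis n_gt0 : (0 < n)%N.

(* The cloud carries the common message and one part of the private message of the receivers
   other than [k], the satellite the other part. *)
Local Notation M0 := ('I_a * 'I_b)%type.
Local Notation Mp := 'I_d.
Local Notation N1 := #|{: 'I_b * 'I_d}|.
Local Notation PUn := (@iid 'I_n U PU).
Local Notation Qn := (@memoryless 'I_n U X Q).
Local Notation Vn j := (@memoryless 'I_n X (Y j) (marg W j)).
Local Notation codebook := {ffun M0 -> {ffun 'I_n -> U} * {ffun Mp -> {ffun 'I_n -> X}}}.

Local Notation book_law := (@codebook_law M0 Mp _ _ PUn Qn).

Variable default : M0 * Mp.

Definition threshold (r : R) : R := Rpower 2 (INR n * (r - delta)).

Definition receiver_decode (j : 'I_K) (w : codebook) (y : {ffun 'I_n -> Y j}) : M0 * Mp :=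
  if j == k then (cloud_decode PUn Qn (Vn j) (threshold (center_rate j)) default.1 w y, default.2)
  else satellite_decode PUn Qn (Vn j) (threshold (satellite_rate j))
         (threshold (codeword_rate j)) default w y.

Definition misdecoded (j : 'I_K) (w : codebook) (m : M0 * Mp) (y : {ffun 'I_n -> Y j}) : bool :=
  if j == k then (receiver_decode w y).1 != m.1 else receiver_decode w y != m.

Definition false_alarms (j : 'I_K) : R :=
  if j == k then INR (a * b).-1 * / threshold (center_rate j)
  else INR d.-1 * / threshold (satellite_rate j) +
       INR (a * b).-1 * (INR d * / threshold (codeword_rate j)).

Lemma misdecoded_le j m :
  \E_(w <- book_law) \Pr_(y <- Vn j (satellite w m)) misdecoded w m y <=
  spread j / (delta * delta) / INR n + false_alarms j.
Proof.
have HV := stochastic_marg HW j.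
have HPUn : is_pmf PUn := pmf_iid _ HPU.
have HQn : stochastic Qn := stochastic_memoryless HQ.
have HVn : stochastic (Vn j) := stochastic_memoryless HV.
have threshold_gt0 r : 0 < threshold r by apply: exp_pos.
have scale v v' : v <= v' -> v / (delta * delta) / INR n <= v' / (delta * delta) / INR n.
  have inv_n := Rinv_0_lt_compat _ (INR_gt0 n_gt0).
  have inv_d := Rinv_0_lt_compat _ (Rmult_lt_0_compat _ _ delta_gt0 delta_gt0).
  by move=> vv'; apply: Rmult_le_compat_r; first lra; apply: Rmult_le_compat_r; lra.
have triple := pmf_triple_law HPU HQ HV.
have v1 := variance_ge0 triple (center_density PU Q (marg W j)).
have v2 := variance_ge0 triple (satellite_density Q (marg W j)).
have v3 := variance_ge0 triple (codeword_density PU Q (marg W j)).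
rewrite -(expect_joint _ _ (fun wy => indic (misdecoded wy.1 m wy.2))).
rewrite /misdecoded /false_alarms /receiver_decode; case: (j == k).
  apply: Rle_trans (cloud_decode_error HPUn HQn HVn (threshold_gt0 _) default.1 m) _.
  rewrite card_prod !card_ord; apply: Rplus_le_compat_r.
  apply: Rle_trans (cloud_miss_le HPU HQ HV n_gt0 delta_gt0) _.
  by apply: scale; rewrite /spread; lra.
apply: Rle_trans
  (satellite_decode_error HPUn HQn HVn (threshold_gt0 _) (threshold_gt0 _) default m) _.
rewrite card_prod !card_ord; apply: Rplus_le_compat_r.
apply: Rle_trans (satellite_miss_le HPU HQ HV n_gt0 delta_gt0) _.
by apply: scale; rewrite /spread; lra.
Qed.

Lemma expect_marg (x : {ffun 'I_n -> X}) j (F : {ffun 'I_n -> Y j} -> R) :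
  \E_(y <- memoryless W x) F [ffun t => y t j] = \E_(z <- Vn j x) F z.
Proof.
rewrite -(expect_image _ (fun y : {ffun 'I_n -> outT Y} => [ffun t => y t j])).
apply: eq_bigr => z _; rewrite (prod_law_image _ (fun y : outT Y => y j)); congr (_ * _).
by apply: eq_bigr => t _; rewrite marg_image_law.
Qed.

Definition message_index (m : 'I_N1 * 'I_a) : M0 * Mp :=
  ((m.2, (enum_val m.1).1), (enum_val m.1).2).

Definition code_of_book (w : codebook) : code X Y n N1 a :=
  Code (fun m1 m2 t => satellite w (message_index (m1, m2)) t)
    (fun j y => let m := @receiver_decode j w [ffun t => y t] in
       (enum_rank (m.1.2, m.2), m.1.1)).

Lemma err_event_misdecoded w (m : 'I_N1 * 'I_a) (y : {ffun 'I_n -> outT Y}) :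
  indic (err_event (code_of_book w) m.1 m.2 y) <=
  \sum_j indic (@misdecoded j w (message_index m) [ffun t => y t j]).
Proof.
have terms_ge0 j : 0 <= indic (@misdecoded j w (message_index m) [ffun t => y t j]).
  exact: indic_ge0.
case: (boolP (err_event _ _ _ _)) => [/existsP[j err]|_]; last exact: sumR_ge0.
apply: Rle_trans (leR_sum_term j terms_ge0).
suff -> : @misdecoded j w (message_index m) [ffun t => y t j] by apply: Rle_refl.
move: err; rewrite /misdecoded (req1E rcv_k) /code_of_book /=; set m' := receiver_decode _ _.
case: (j == k) => /=; first by case/andP => _; apply: contraNneq => ->.
apply: contraTneq => ->; rewrite /message_index /= -surjective_pairing enum_valK.
by rewrite !eqxx !andbF.
Qed.

Lemma Pe_code_of_book_le w : Pe W (code_of_book w) <=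
  \E_(m <- @uniform _) \sum_j \Pr_(y <- Vn j (satellite w (message_index m)))
                              @misdecoded j w (message_index m) y.
Proof.
rewrite PeE; apply: leR_expect => m.
  by apply/pmf_ge0/pmf_uniform/card_gt0P; exists m.
have -> : codeword (code_of_book w) m = satellite w (message_index m).
  by apply/ffunP => t; rewrite ffunE /= -surjective_pairing.
under eq_bigr => j _ do rewrite -expect_marg.
rewrite -expect_sum; apply: leR_expect => y; last exact: err_event_misdecoded.
by apply: pmf_ge0; apply: stochastic_memoryless.
Qed.

Lemma random_code : exists c : code X Y n N1 a,
  Pe W c <= \sum_j (spread j / (delta * delta) / INR n + false_alarms j).
Proof.
have Hbook : is_pmf (book_law).
  by apply: pmf_codebook_law; [apply: pmf_iid | apply: stochastic_memoryless].
have Hmsg : is_pmf (@uniform ('I_N1 * 'I_a)%type).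
  case: (default) => -[i i'] i''; apply/pmf_uniform/card_gt0P.
  by exists (enum_rank (i', i''), i).
suff /(exists_le_expect Hbook)[w le_w] : \E_(w <- book_law) Pe W (code_of_book w)
    <= \sum_j (spread j / (delta * delta) / INR n + false_alarms j).
  by exists (code_of_book w).
apply: Rle_trans (leR_expect (pmf_ge0 Hbook) Pe_code_of_book_le) _.
rewrite expect_exchange -[X in _ <= X](expect_const _ Hmsg).
apply: leR_expect => m; first exact: pmf_ge0.
by rewrite expect_sum; apply: leR_sum => j _; apply: misdecoded_le.
Qed.

End RandomCode.

(** * Codebook sizes *)

Definition codebook_size (x : R) : nat := (Num.trunc (Rpower 2 x)).+1.

Lemma Rpower2_gt0 x : 0 < Rpower 2 x.
Proof. exact: exp_pos. Qed.

Lemma leR_Rpower2 x y : x <= y -> Rpower 2 x <= Rpower 2 y.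
Proof. by apply: Rle_Rpower; lra. Qed.

Lemma Rpower2_ge1 x : 0 <= x -> 1 <= Rpower 2 x.
Proof. by move=> /leR_Rpower2; rewrite Rpower_O; lra. Qed.

Lemma codebook_size_pred_le x : INR (codebook_size x).-1 <= Rpower 2 x.
Proof.
by rewrite INRE; apply/RleP; rewrite Num.Theory.truncn_le; apply/RleP/Rlt_le/Rpower2_gt0.
Qed.

Lemma codebook_size_ge x : Rpower 2 (Rmax 0 x) <= INR (codebook_size x).
Proof.
apply: (Rmax_case _ _ (fun y => Rpower 2 y <= _)); first last.
  by rewrite INRE; apply/Rlt_le/RltP/Num.Theory.truncnS_gt.
by rewrite Rpower_O ?S_INR; [have := pos_INR (Num.trunc (Rpower 2 x)); lra | lra].
Qed.

Lemma codebook_size_le x : INR (codebook_size x) <= 2 * Rpower 2 (Rmax 0 x).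
Proof.
have := codebook_size_pred_le x; rewrite [in X in _ -> X]S_INR.
have := leR_Rpower2 (Rmax_r 0 x); have := Rpower2_ge1 (Rmax_l 0 x); rewrite /=; lra.
Qed.

Lemma codebook_size_mul_pred_le x y t : x + Rmax 0 y <= t -> y <= t ->
  INR (codebook_size x * codebook_size y).-1 <= 3 * Rpower 2 t.
Proof.
move=> /leR_Rpower2; rewrite Rpower_plus => xy_t /leR_Rpower2 y_t.
have -> : (codebook_size x * codebook_size y).-1 =
    ((codebook_size x).-1 * codebook_size y + (codebook_size y).-1)%N by rewrite mulSn addSn addnC.
rewrite plus_INR mult_INR; have y_pred := codebook_size_pred_le y.
have := Rmult_le_compat _ _ _ _ (pos_INR _) (pos_INR _)
  (codebook_size_pred_le x) (codebook_size_le y).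
by lra.
Qed.

Lemma Rpower2_neg_le n x : (0 < n)%N -> 0 < x -> Rpower 2 (- (INR n * x)) <= / (x * ln 2) / INR n.
Proof.
move=> /INR_gt0 n0 x0; have ln20 := ln2_gt0.
have nx0 : 0 < INR n * x * ln 2 by do 2!apply: Rmult_lt_0_compat => //.
rewrite Rpower_Ropp; have -> : / (x * ln 2) / INR n = / (INR n * x * ln 2).
  by field; repeat split; lra.
by apply: Rinv_le_contravar => //; have := exp_ineq1_le (INR n * x * ln 2); rewrite /Rpower; lra.
Qed.

(** * Achievability *)

Section Achievability.
Variables (K : nat) (X : finType) (Y : 'I_K -> finType) (W : X -> outT Y -> R).
Hypothesis HW : is_channel W.
Variables (U : finType) (PU : U -> R) (Q : U -> X -> R).
Hypotheses (HPU : is_pmf PU) (HQ : stochastic Q).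
Variables (k : 'I_K) (delta r2 r10 r11 : R).
Hypotheses (rcv_k : rcv k = K) (delta_gt0 : 0 < delta).
Hypotheses (r2_ge0 : 0 <= r2) (r10_ge0 : 0 <= r10) (r11_ge0 : 0 <= r11).
Hypothesis cloud_decodable : r2 + r10 <= center_rate W PU Q k.
Hypothesis satellite_decodable : forall j, j != k -> r11 <= satellite_rate W PU Q j.
Hypothesis all_decodable : forall j, j != k -> r2 + r10 + r11 <= codeword_rate W PU Q j.

Definition layer_size (r : R) (n : nat) : nat := codebook_size (INR n * (r - 2 * delta)).

(* Rates stay [2 delta] below the informations and thresholds [delta] below, so each false alarm
   probability decays like [2 ^ (- n delta)]. *)
Lemma over_threshold_le n r r' v C : r <= r' -> v <= C * Rpower 2 (INR n * (r - 2 * delta)) ->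
  0 <= C -> v * / threshold delta n r' <= C * Rpower 2 (- (INR n * delta)).
Proof.
move=> rr' v_le C0; rewrite -Rpower_Ropp.
have -> : - (INR n * delta) = INR n * (r' - 2 * delta) + - (INR n * (r' - delta)) by ring.
rewrite Rpower_plus -Rmult_assoc; apply: Rmult_le_compat_r; first exact/Rlt_le/Rpower2_gt0.
apply: Rle_trans v_le _; apply: Rmult_le_compat_l => //; apply: leR_Rpower2.
by apply: Rmult_le_compat_l; [apply: pos_INR | lra].
Qed.

Lemma layer_size_mul_pred_le n :
  INR (layer_size r2 n * layer_size r10 n).-1 <= 3 * Rpower 2 (INR n * (r2 + r10 - 2 * delta)).
Proof.
have n0 := pos_INR n; apply: codebook_size_mul_pred_le; last by apply: Rmult_le_compat_l; lra.
by rewrite /Rmax; case: Rle_dec => _; nra.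
Qed.

Lemma layer_size_le r n : 0 <= r -> INR (layer_size r n) <= 2 * Rpower 2 (INR n * r).
Proof.
move=> r0; have n0 := pos_INR n; apply: Rle_trans (codebook_size_le _) _.
apply: Rmult_le_compat_l; first lra.
by apply: leR_Rpower2; rewrite /Rmax; case: Rle_dec => _; nra.
Qed.

Lemma false_alarms_le n j :
  false_alarms W PU Q k delta n (layer_size r2 n) (layer_size r10 n) (layer_size r11 n) j <=
  7 * Rpower 2 (- (INR n * delta)).
Proof.
have decay0 := Rpower2_gt0 (- (INR n * delta)); rewrite /false_alarms.
case: (eqVneq j k) => [->|jk].
  have := over_threshold_le cloud_decodable (layer_size_mul_pred_le n); lra.
have satellite : INR (layer_size r11 n).-1 * / threshold delta n (satellite_rate W PU Q j) <=
    1 * Rpower 2 (- (INR n * delta)).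
  apply: over_threshold_le (satellite_decodable jk) _ _; last lra.
  by rewrite Rmult_1_l; apply: codebook_size_pred_le.
have all_layers : INR (layer_size r2 n * layer_size r10 n).-1 * INR (layer_size r11 n) *
    / threshold delta n (codeword_rate W PU Q j) <= 6 * Rpower 2 (- (INR n * delta)).
  apply: over_threshold_le (all_decodable jk) _ _; last lra.
  have -> : INR n * (r2 + r10 + r11 - 2 * delta) = INR n * (r2 + r10 - 2 * delta) + INR n * r11.
    ring.
  rewrite Rpower_plus; have := Rmult_le_compat _ _ _ _ (pos_INR _) (pos_INR _)
    (layer_size_mul_pred_le n) (layer_size_le n r11_ge0).
  lra.
by rewrite -Rmult_assoc; lra.
Qed.

Definition error_constant : R :=
  \sum_j (spread W PU Q j / (delta * delta) + 7 * / (delta * ln 2)).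

Lemma exists_code n : exists c : code X Y n #|{: 'I_(layer_size r10 n) * 'I_(layer_size r11 n)}|
    (layer_size r2 n), (0 < n)%N -> Pe W c <= error_constant / INR n.
Proof.
case: n => [|n].
  by exists (Code (fun _ _ (t : 'I_0) => False_rect X (notF (ltn_ord t)))
    (fun _ _ => (enum_rank (ord0, ord0), ord0))).
have [c Pe_c] := random_code HW HPU HQ rcv_k delta_gt0 (ltn0Sn n) (a := layer_size r2 n.+1)
  (b := layer_size r10 n.+1) (d := layer_size r11 n.+1) (ord0, ord0, ord0).
exists c => _; apply: Rle_trans Pe_c _.
rewrite /error_constant /Rdiv -sumR_mulr; apply: leR_sum => j _.
rewrite Rmult_plus_distr_r; apply: Rplus_le_compat_l; apply: Rle_trans (false_alarms_le n.+1 j) _.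
rewrite Rmult_assoc; apply: Rmult_le_compat_l; first lra.
exact: Rpower2_neg_le.
Qed.

Lemma superposition_achievable :
  achievable W (Rmax 0 (r10 - 2 * delta) + Rmax 0 (r11 - 2 * delta)) (Rmax 0 (r2 - 2 * delta)).
Proof.
have size_ge r n : Rpower 2 (INR n * Rmax 0 (r - 2 * delta)) <= INR (layer_size r n).
  rewrite -RmaxRmult ?Rmult_0_r; [exact: codebook_size_ge | exact: pos_INR].
have max0 r := Rmax_l 0 r.
split; first exact: Rplus_le_le_0_compat; split=> //.
exists (fun n => #|{: 'I_(layer_size r10 n) * 'I_(layer_size r11 n)}|), (layer_size r2),
  (fun n => sval (cid (exists_code n))); split; [|split] => [n|n|].
- rewrite card_prod !card_ord mult_INR Rmult_plus_distr_l Rpower_plus.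
  by apply: Rmult_le_compat => //; apply/Rlt_le/Rpower2_gt0.
- exact: size_ge.
apply: (@Un_cv_dominated0 _ (fun n => / INR n * error_constant) 1%N) => [n n_gt0|].
  rewrite Rmult_comm Rabs_right; first by case: cid => c; apply.
  by apply/Rle_ge/Pe_ge0; rewrite ?card_prod ?card_ord.
by rewrite -(Rmult_0_l error_constant); apply/Un_cv_mulr/Un_cv_inv_INR.
Qed.

End Achievability.

(** * The capacity region *)

Section CapacityRegion.
Variables (K : nat) (X : finType) (Y : 'I_K -> finType) (W : X -> outT Y -> R).
Hypothesis HW : is_channel W.
Variables (k s : 'I_K).
Hypotheses (rcv_k : rcv k = K) (rcv_s : rcv s = K.-1).
Hypothesis Hclass : classA W \/ classB W.

Lemma sum_rate_le_in_info (U : finType) (p : U -> X -> R) r2 r12 j :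
  is_pmf2 p -> rate_bounds (marg W) k s p r2 r12 -> j != k ->
  r12 <= in_info (marg W j) (mixture p).
Proof.
move=> Hp [_ b12 bs] jk; have [p0 _] := Hp.
case: Hclass => [/(classA_more_capable rcv_k rcv_s)[mc_s _]|/(classB_less_noisy rcv_k) ln].
  case: (eqVneq j s) => [-> //|js]; apply: Rle_trans bs _.
  by apply: more_capable_in_info (mc_s _ jk js) _ => //; apply: mixture_ge0.
apply: Rle_trans (b12 j jk) _; rewrite -mix_info_in_info Rplus_comm.
by apply: Rplus_le_compat_r; apply: less_noisy_mix_info => //; apply: ln.
Qed.

(* Rate splitting: as much of the private message as possible is moved to the cloud. *)
Lemma rate_bounds_split (U : finType) (p : U -> X -> R) R1 R2 :
  is_pmf2 p -> 0 <= R1 -> rate_bounds (marg W) k s p R2 (R2 + R1) ->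
  exists r10 r11, [/\ 0 <= r10, 0 <= r11, r10 + r11 = R1, R2 + r10 <= mix_info (marg W k) p &
    forall j, j != k -> r11 <= \sum_u in_info (marg W j) (p u)].
Proof.
move=> [p0 _] R1_ge0 [b2 b12 _]; pose r10 := Rmin R1 (mix_info (marg W k) p - R2).
have r10_le1 : r10 <= R1 := Rmin_l _ _.
have r10_le2 : r10 <= mix_info (marg W k) p - R2 := Rmin_r _ _.
exists r10, (R1 - r10); split; try lra; first by apply: Rmin_glb; lra.
move=> j jk; have := b12 j jk.
have : 0 <= \sum_u in_info (marg W j) (p u).
  by apply: sumR_ge0 => u _; apply: in_info_ge0 => //; apply: stochastic_marg.
by rewrite /r10 /Rmin; case: Rle_dec => _; lra.
Qed.

Lemma rate_bounds_capacity (U : finType) (p : U -> X -> R) R1 R2 :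
  0 <= R1 -> 0 <= R2 -> is_pmf2 p -> rate_bounds (marg W) k s p R2 (R2 + R1) ->
  capacity_region W R1 R2.
Proof.
move=> R1_ge0 R2_ge0 Hp bounds eps eps_gt0; have HV := stochastic_marg HW.
have [r10 [r11 [r10_ge0 r11_ge0 split_R1 cloud_le satellite_le]]] :=
  rate_bounds_split Hp R1_ge0 bounds.
have [PU [Q [HPU HQ pE]]] := disintegration Hp.
have near r : 0 <= r -> r - 2 * (eps / 5) <= Rmax 0 (r - 2 * (eps / 5)) <= r.
  by move=> r0; rewrite /Rmax; case: Rle_dec => ?; split; lra.
exists (Rmax 0 (r10 - 2 * (eps / 5)) + Rmax 0 (r11 - 2 * (eps / 5))), (Rmax 0 (R2 - 2 * (eps / 5))).
have [lo10 hi10] := near _ r10_ge0; have [lo11 hi11] := near _ r11_ge0.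
have [lo2 hi2] := near _ R2_ge0.
split; last by split; apply: Rabs_def1; lra.
apply: (superposition_achievable HW HPU HQ rcv_k) => // [||j jk|j jk]; first lra.
- by rewrite /center_rate (mix_info_disintegration HPU HQ pE).
- by rewrite /satellite_rate (in_info_disintegration HPU HQ pE) //; apply: satellite_le.
rewrite /codeword_rate (output_disintegration pE) Rplus_assoc split_R1.
exact: sum_rate_le_in_info bounds jk.
Qed.

Lemma capacity_region_ge0 R1 R2 : capacity_region W R1 R2 -> 0 <= R1 /\ 0 <= R2.
Proof.
move=> cap; split; apply: Rnot_lt_le => neg.
  have [|r1 [r2 [[r1_ge0 _] [/Rabs_def2[near _] _]]]] := cap (- R1); lra.
have [|r1 [r2 [[_ [r2_ge0 _]] [_ /Rabs_def2[near _]]]]] := cap (- R2); lra.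
Qed.

Lemma capacity_rate_bounds R1 R2 : capacity_region W R1 R2 ->
  exists (U : finType) (p : U -> X -> R),
    is_pmf2 p /\ rate_bounds (marg W) k s p R2 (R2 + R1).
Proof.
move=> cap; apply: rate_bounds_closed => [j|d d_gt0]; first exact: stochastic_marg.
have [|r1 [r2 [ach [/Rabs_def2[_ near1] /Rabs_def2[_ near2]]]]] := cap (d / 4); first lra.
have [|U [p [Hp bounds]]] := achievable_rate_bounds HW rcv_k rcv_s Hclass (d := d / 2) ach.
  lra.
by exists U, p; split=> //; apply: rate_bounds_le bounds; lra.
Qed.

End CapacityRegion.

Lemma exists_last_receivers K : (1 < K)%N -> exists k s : 'I_K, rcv k = K /\ rcv s = K.-1.
Proof. by case: K => [|[|K]] // _; exists ord_max, (widen_ord (leqnSn _) ord_max). Qed.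

Theorem theorem2 (K : nat) (hK : (3 <= K)%N)
  (X : finType) (Y : 'I_K -> finType) (W : X -> outT Y -> R)
  (HW : is_channel W) (Hclass : classA W \/ classB W) (R1 R2 : R) :
  capacity_region W R1 R2 <-> region W R1 R2.
Proof.
have [k [s [rcv_k rcv_s]]] := exists_last_receivers (ltnW hK).
rewrite (regionE HW rcv_k rcv_s); split=> [cap|[R1_ge0 [R2_ge0 [U [p [Hp bounds]]]]]].
  have [R1_ge0 R2_ge0] := capacity_region_ge0 cap.
  by split=> //; split=> //; apply: (capacity_rate_bounds HW rcv_k rcv_s Hclass).
exact: (rate_bounds_capacity HW rcv_k rcv_s Hclass R1_ge0 R2_ge0 Hp bounds).
Qed.
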